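(* Let $\Phi_1$ and $\Phi_2$ be two growth functions in $\mathscr{U}$. Assume that $\Phi_1$ satisfies the $\nabla_2$-condition and that $\frac{\Phi_2}{\Phi_1}$ is nondecreasing. Let $\mu$ be a positive Borel measure on $\mathbb{C}_+$ and let $\alpha>-1$. Then the following assertions are equivalent. (a) There exists a constant $C_1>0$ such that for any interval $I\subset \mathbb{R}$, $\mu(Q_I)\le \dfrac{C_1}{\Phi_2\circ\Phi_1^{-1}\left(\frac{1}{|I|^{2+\alpha}}\right)}$. (b) There exists a constant $C_2>0$ such that for any $f\in A_\alpha^{\Phi_1}(\mathbb{C}_+)$, $f\neq 0$, $$\sup_{\lambda>0}\Phi_2(\lambda)\,\mu\left(\left\{z\in \mathbb{C}_+:\,|f(z)|>C_2\lambda\|f\|_{\Phi_1,\alpha}^{lux} \right\}\right)\le 1.$$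
   Context: $\mathbb{C}_+=\{x+iy: y>0\}$. A growth function is a continuous nondecreasing function from $[0,\infty)$ onto $[0,\infty)$; $\Phi^{-1}$ is its inverse. $\mathscr{U}^q$ ($q\ge1$) is the set of growth functions $\Phi$ with $\Phi(st)\le Ct^q\Phi(s)$ for $s>0,t\ge1$ and $t\mapsto\Phi(t)/t$ nondecreasing; $\mathscr{U}=\bigcup_{q\ge1}\mathscr{U}^q$. A growth function satisfies the $\nabla_2$-condition if both it and its complementary function $\Psi(s)=\sup_{t\ge0}\{ts-\Phi(t)\}$ satisfy $F(2t)\le KF(t)$ for some $K>1$, all $t\ge0$. $Q_I=\{x+iy:x\in I,0<y<|I|\}$. $dV_\alpha(x+iy)=y^\alpha dxdy$; $A^\Phi_\alpha(\mathbb{C}_+)$: holomorphic $f$ with $\int\Phi(|f|)dV_\alpha<\infty$, with $\|f\|^{lux}_{\Phi,\alpha}=\inf\{\lambda>0:\int_{\mathbb{C}_+}\Phi(|f|/\lambda)dV_\alpha\le1\}$. *)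

(* Defs.v *)
From mathcomp Require Import all_boot all_order all_algebra.
From mathcomp Require Import all_classical all_reals all_analysis.
Set Implicit Arguments.
Unset Strict Implicit.
Unset Printing Implicit Defensive.
Import Order.TTheory GRing.Theory Num.Theory.
Import numFieldNormedType.Exports.
Local Open Scope classical_set_scope.
Local Open Scope ring_scope.

Section Defs.
Variable R : realType.

(** The complex plane is modelled as R * R, z = (x, y) <-> x + i y. *)
Definition cmul (a b : R * R) : R * R :=
  (a.1 * b.1 - a.2 * b.2, a.1 * b.2 + a.2 * b.1).
Definition cadd (a b : R * R) : R * R := (a.1 + b.1, a.2 + b.2).
Definition csub (a b : R * R) : R * R := (a.1 - b.1, a.2 - b.2).
Definition cnorm (a : R * R) : R := Num.sqrt (a.1 ^+ 2 + a.2 ^+ 2).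

Definition Cplus : set (R * R) := [set z | 0 < z.2].

Definition holomorphic_on (D : set (R * R)) (f : R * R -> R * R) : Prop :=
  forall z, D z -> exists c : R * R, forall e : R, 0 < e ->
    exists d : R, 0 < d /\ forall h : R * R, 0 < cnorm h < d ->
      cnorm (csub (csub (f (cadd z h)) (f z)) (cmul c h)) <= e * cnorm h.

Definition growth_function (Phi : R -> R) : Prop :=
  [/\ {within `[0%R, +oo[, continuous Phi},
      (forall s t : R, 0 <= s -> s <= t -> Phi s <= Phi t) &
      Phi @` [set t : R | 0 <= t] = [set t : R | 0 <= t]].

(** Inverse of a growth function: Phi^{-1}(s) = sup {t >= 0 : Phi t <= s}
    (for the strictly increasing growth functions of class U this is the
    genuine inverse). *)
Definition growth_inv (Phi : R -> R) (s : R) : R :=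
  sup [set t : R | 0 <= t /\ Phi t <= s].

Definition class_Uq (q : R) (Phi : R -> R) : Prop :=
  [/\ growth_function Phi,
      (exists C : R, forall s t : R, 0 < s -> 1 <= t ->
          Phi (s * t) <= C * t `^ q * Phi s) &
      (forall s t : R, 0 < s -> s <= t -> Phi s / s <= Phi t / t)].

Definition class_U (Phi : R -> R) : Prop :=
  exists q : R, 1 <= q /\ class_Uq q Phi.

Definition complementary (Phi : R -> R) (s : R) : \bar R :=
  ereal_sup [set ((t * s - Phi t)%:E) | t in [set t : R | 0 <= t]].

Definition doubling (F : R -> \bar R) : Prop :=
  exists K : R, 1 < K /\ forall t : R, 0 <= t -> (F (2 * t)%R <= K%:E * F t)%E.

Definition nabla2 (Phi : R -> R) : Prop :=
  doubling (fun t => (Phi t)%:E) /\ doubling (complementary Phi).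

Definition orlicz_integral (Phi : R -> R) (alpha : R) (f : R * R -> R * R)
    (lam : R) : \bar R :=
  (\int[(@lebesgue_measure R \x @lebesgue_measure R)%E]_(z in Cplus)
     ((Phi (cnorm (f z) / lam) * z.2 `^ alpha)%:E))%E.

Definition bergman_orlicz (Phi : R -> R) (alpha : R) (f : R * R -> R * R) : Prop :=
  holomorphic_on Cplus f /\ (orlicz_integral Phi alpha f 1 < +oo)%E.

Definition lux_norm (Phi : R -> R) (alpha : R) (f : R * R -> R * R) : R :=
  inf [set lam : R | 0 < lam /\ (orlicz_integral Phi alpha f lam <= 1)%E].

Definition carleson_box (I : set R) (len : R) : set (R * R) :=
  [set z | I z.1 /\ 0 < z.2 < len].

End Defs.

(* Main.v *)
From HB Require Import structures.
Require Import Defs.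
From mathcomp Require Import all_boot all_order all_algebra.
From mathcomp Require Import all_classical all_reals all_analysis.
From mathcomp Require Import measurable_realfun.
From mathcomp Require Import ring lra.
Import Order.TTheory GRing.Theory Num.Theory.
Import numFieldNormedType.Exports.
Import Defs.
Set Implicit Arguments.
Unset Strict Implicit.
Local Open Scope classical_set_scope.
Local Open Scope ring_scope.

(* The weak type estimate is local. By Cauchy's theorem (Goursat's lemma on squares applied to a
   difference quotient), |f(p)| is at most a constant times the average of |f| over a square
   centred at [p]; as Phi1(t)/t is nondecreasing, a value |f(p)| > 20 lam eta at a point [p] of
   height about [h] forces h^(2+alpha) Phi1(lam) to be at most a constant times the integral of
   Phi1(|f|/eta) dV_alpha over the neighbours of the Whitney square containing [p]. Summing the
   Carleson bounds of the Whitney squares that meet {|f| > 20 lam eta} gives the estimate: each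
   of them has side O(Phi1(lam)^(-1/(2+alpha))), t -> 1/(t Phi2(Phi1^-1(1/t))) is nondecreasing
   because Phi2/Phi1 is, and the neighbourhoods overlap at most nine times.
   Conversely, the weak type estimate is tested on s0 (L/(z - (c - i L)))^M with
   s0 = Phi1^-1(1/L^(2+alpha)), whose Luxemburg norm is bounded uniformly in c and L. *)

(** The bound in (b) is exactly 1, so every constant has to be moved into the level. Since
    [Phi (k * s) <= k * Phi s] for k in [0, 1], a factor outside a growth function can be traded for
    a factor of its argument, and all geometric constants end up in [C2]. Sharp constants are
    therefore pointless: squares replace discs, 4 replaces 2 pi, and only integrals along sides
    parallel to the axes occur. Growth functions need not be convex, so Jensen's inequality is
    replaced by the elementary bound t <= lam + lam / Phi(lam) * Phi(t). The difficulty in the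
    summation is that the Carleson bound of a Whitney square is not linear in t = (2 h)^(2 + alpha).
    Write G for Phi2 o Phi1^-1. Once 1 / t >= s0 for a fixed s0 proportional to Phi1(lam), the
    monotone quotient gives 1 / G(1 / t) <= t * s0 / G(s0). This is linear in t, hence at most a
    multiple of the local integral, and local integrals can be summed. *)

Section ComplexPlane.
Variable R : realType.
Implicit Types (a b c z w h p : R * R) (f g : R * R -> R * R).

(** * Modulus, inverse and complex derivative on [R * R] *)

Lemma cnorm_ge0 a : 0 <= cnorm a.
Proof. exact: sqrtr_ge0. Qed.

Lemma sqr_cnorm a : cnorm a ^+ 2 = a.1 ^+ 2 + a.2 ^+ 2.
Proof. by rewrite sqr_sqrtr// addr_ge0// sqr_ge0. Qed.

Lemma cnorm_leP a (M : R) : 0 <= M -> (cnorm a <= M) = (a.1 ^+ 2 + a.2 ^+ 2 <= M ^+ 2).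
Proof. by move=> M0; rewrite -sqr_cnorm ler_sqr// nnegrE cnorm_ge0. Qed.

Lemma cnormM a b : cnorm (cmul a b) = cnorm a * cnorm b.
Proof.
rewrite /cnorm -sqrtrM; last by rewrite addr_ge0// sqr_ge0.
by congr Num.sqrt; rewrite /cmul /=; ring.
Qed.

Lemma cnorm_eq0 a : (cnorm a == 0) = (a == (0, 0)).
Proof.
case: a => x y; rewrite -[cnorm _ == 0](@expf_eq0 _ _ 2) sqr_cnorm/=.
by rewrite paddr_eq0 ?sqr_ge0// !expf_eq0/= xpair_eqE.
Qed.

Lemma cnorm0 : cnorm (0, 0) = 0 :> R.
Proof. by apply/eqP; rewrite cnorm_eq0. Qed.

Lemma cnorm_gt0 a : (0 < cnorm a) = (a != (0, 0)).
Proof. by rewrite lt0r cnorm_ge0 andbT cnorm_eq0. Qed.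

Lemma normr_fst_le a : `|a.1| <= cnorm a.
Proof. by rewrite -ler_sqr ?nnegrE ?cnorm_ge0// sqr_cnorm real_normK ?num_real// lerDl sqr_ge0. Qed.

Lemma normr_snd_le a : `|a.2| <= cnorm a.
Proof. by rewrite -ler_sqr ?nnegrE ?cnorm_ge0// sqr_cnorm real_normK ?num_real// lerDr sqr_ge0. Qed.

Lemma cnorm_le_normD a : cnorm a <= `|a.1| + `|a.2|.
Proof.
rewrite cnorm_leP ?addr_ge0// sqrrD !real_normK ?num_real//.
by rewrite addrAC lerDl mulrn_wge0 // mulr_ge0.
Qed.

Lemma le_cnormD a b : cnorm (cadd a b) <= cnorm a + cnorm b.
Proof.
rewrite cnorm_leP ?addr_ge0 ?cnorm_ge0// [leRHS]sqrrD !sqr_cnorm /cadd /=.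
suff : a.1 * b.1 + a.2 * b.2 <= cnorm a * cnorm b by lra.
rewrite (le_trans (ler_norm _))// -ler_sqr ?nnegrE ?mulr_ge0 ?cnorm_ge0//.
rewrite real_normK ?num_real// exprMn !sqr_cnorm.
have := sqr_ge0 (a.1 * b.2 - a.2 * b.1); lra.
Qed.

Lemma cnormBC a b : cnorm (csub a b) = cnorm (csub b a).
Proof. by rewrite /cnorm /csub /=; congr Num.sqrt; ring. Qed.

Lemma cnormN a : cnorm (csub (0, 0) a) = cnorm a.
Proof. by rewrite cnormBC /cnorm /csub /= !subr0. Qed.

Lemma caddK z w : cadd z (csub w z) = w.
Proof. by case: z w => [? ?] [? ?]; congr pair => /=; ring. Qed.

Lemma csubK z h : csub (cadd z h) z = h.
Proof. by case: z h => [? ?] [? ?]; congr pair => /=; ring. Qed.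

Lemma csub_eq0 z w : (csub z w == (0, 0)) = (z == w).
Proof. by case: z w => [? ?] [? ?]; rewrite /csub !xpair_eqE !subr_eq0. Qed.

Lemma cadd0 z : cadd z (0, 0) = z.
Proof. by case: z => ? ?; rewrite /cadd/= !addr0. Qed.

Lemma le_csubl a b : cnorm a <= cnorm b + cnorm (csub a b).
Proof. by rewrite -{1}(caddK b a) le_cnormD. Qed.

Lemma cmulBr a b c : cmul a (csub b c) = csub (cmul a b) (cmul a c).
Proof. by congr pair => /=; ring. Qed.

(** Division by zero being zero, [cinv (0, 0)] is [(0, 0)], and [cnormV] holds without a side
    condition. *)
Definition cinv a : R * R :=
  (a.1 / (a.1 ^+ 2 + a.2 ^+ 2), - a.2 / (a.1 ^+ 2 + a.2 ^+ 2)).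

Lemma cmulV a : a != (0, 0) -> cmul a (cinv a) = (1, 0).
Proof.
move=> a0; have : a.1 ^+ 2 + a.2 ^+ 2 != 0.
  by rewrite -sqr_cnorm expf_eq0/= cnorm_eq0.
by move=> n0; congr pair => /=; field.
Qed.

Lemma cnorm1 : cnorm (1, 0) = 1 :> R.
Proof. by rewrite /cnorm /= expr1n expr0n addr0 sqrtr1. Qed.

Lemma cnormV a : cnorm (cinv a) = (cnorm a)^-1.
Proof.
have [->|a0] := eqVneq a (0, 0); first by rewrite cnorm0 invr0 /cinv/= oppr0 !mul0r cnorm0.
have n0 : cnorm a != 0 by rewrite cnorm_eq0.
by apply: (mulfI n0); rewrite -cnormM cmulV// cnorm1 divff.
Qed.

Definition is_cderiv f z c := forall e : R, 0 < e -> exists2 d : R, 0 < d &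
  forall h, cnorm h < d ->
    cnorm (csub (csub (f (cadd z h)) (f z)) (cmul c h)) <= e * cnorm h.

Definition ccontinuous_at g z := forall e : R, 0 < e -> exists2 d : R, 0 < d &
  forall h, cnorm h < d -> cnorm (csub (g (cadd z h)) (g z)) <= e.

Lemma holomorphic_onP D f : holomorphic_on D f <->
  forall z, D z -> exists c, is_cderiv f z c.
Proof.
split=> fD z /fD[c fc]; exists c => e e0.
- have [d [d0 dP]] := fc e e0; exists d => // h hd; have [->|h0] := eqVneq h (0, 0); last first.
    by apply: dP; rewrite cnorm_gt0 h0.
  by rewrite cadd0 cnorm0 mulr0 /csub /cmul/= !mulr0 !subrr addr0 subr0 cnorm0.
- have [d d0 dP] := fc e e0; by exists d; split=> // h /andP[_]; exact: dP.
Qed.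

Lemma is_cderiv_lipschitz f z c : is_cderiv f z c -> exists2 d : R, 0 < d &
  forall h, cnorm h < d -> cnorm (csub (f (cadd z h)) (f z)) <= (1 + cnorm c) * cnorm h.
Proof.
move=> /(_ 1 ltr01)[d d0 dP]; exists d => // h /dP.
have := le_csubl (csub (f (cadd z h)) (f z)) (cmul c h).
by rewrite cnormM; lra.
Qed.

Lemma is_cderiv_continuous f z c : is_cderiv f z c -> ccontinuous_at f z.
Proof.
move=> /is_cderiv_lipschitz[d d0 dP] e e0.
have c1 : 0 < 1 + cnorm c by have := cnorm_ge0 c; lra.
exists (Num.min d (e / (1 + cnorm c))); first by rewrite lt_min d0 divr_gt0.
move=> h; rewrite lt_min => /andP[/dP H he]; apply: (le_trans H).
by rewrite mulrC -ler_pdivlMr// ltW.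
Qed.

Arguments is_cderiv_continuous {f z c} _ e _.

Lemma is_cderiv_near f g z c (r : R) : 0 < r ->
  (forall h, cnorm h < r -> f (cadd z h) = g (cadd z h)) ->
  is_cderiv f z c -> is_cderiv g z c.
Proof.
move=> r0 fg fc e /fc[d d0 dP]; exists (Num.min d r); first by rewrite lt_min d0.
move=> h; rewrite lt_min => /andP[/dP + hr]; rewrite fg//.
by have := fg (0, 0); rewrite !cadd0 => ->//; rewrite cnorm0.
Qed.

Lemma is_cderiv_cst c z : is_cderiv (fun=> c) z (0, 0).
Proof.
move=> e e0; exists 1 => // h _.
by rewrite /csub /cmul/= !mul0r !subrr addr0 subr0 cnorm0 mulr_ge0 ?cnorm_ge0// ltW.
Qed.

Lemma is_cderiv_subc f z c a : is_cderiv f z c -> is_cderiv (fun w => csub (f w) a) z c.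
Proof.
move=> fc e /fc[d d0 dP]; exists d => // h /dP.
suff -> : csub (csub (f (cadd z h)) a) (csub (f z) a) = csub (f (cadd z h)) (f z) by [].
by congr pair => /=; ring.
Qed.

Lemma is_cderivM f g z c b : is_cderiv f z c -> is_cderiv g z b ->
  is_cderiv (fun w => cmul (f w) (g w)) z (cadd (cmul c (g z)) (cmul (f z) b)).
Proof.
move=> fc gb e e0.
(* The error is a sum of three products, each allotted [e / 3]. The added 1 keeps the divisors
   positive, and in [F] it also covers [f] at the displaced point. *)
set F := cnorm (f z) + 1; set G := cnorm (g z) + 1; set B := cnorm b + 1.
have F0 : 0 < F by have := cnorm_ge0 (f z); rewrite /F; lra.
have G0 : 0 < G by have := cnorm_ge0 (g z); rewrite /G; lra.
have B0 : 0 < B by have := cnorm_ge0 b; rewrite /B; lra.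
have [d1 d10 P1] := gb (e / 3 / F) ltac:(by rewrite !divr_gt0).
have [d2 d20 P2] := fc (e / 3 / G) ltac:(by rewrite !divr_gt0).
have [d3 d30 P3] := is_cderiv_continuous fc (Num.min 1 (e / 3 / B))
  ltac:(by rewrite lt_min ltr01 !divr_gt0).
exists (Num.min d1 (Num.min d2 d3)); first by rewrite !lt_min d10 d20.
move=> h; rewrite !lt_min => /and3P[/P1 H1 /P2 H2 /P3].
rewrite le_min => /andP[H3 H4].
set f' := f (cadd z h) in H2 H3 H4 *; set g' := g (cadd z h) in H1 *.
have -> : csub (csub (cmul f' g') (cmul (f z) (g z)))
    (cmul (cadd (cmul c (g z)) (cmul (f z) b)) h) =
  cadd (cmul f' (csub (csub g' (g z)) (cmul b h)))
    (cadd (cmul (g z) (csub (csub f' (f z)) (cmul c h)))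
      (cmul (cmul b h) (csub f' (f z)))).
  by congr pair => /=; ring.
apply: (le_trans (le_cnormD _ _)).
apply: (le_trans (lerD (lexx _) (le_cnormD _ _))); rewrite !cnormM.
have Ff : cnorm f' <= F by have := le_csubl f' (f z); rewrite /F; lra.
have -> : e * cnorm h = F * (e / 3 / F * cnorm h) +
   (G * (e / 3 / G * cnorm h) + (B * cnorm h) * (e / 3 / B)).
  by field; rewrite !gt_eqF.
have hG : cnorm (g z) <= G by rewrite /G lerDl.
have hB : cnorm b <= B by rewrite /B lerDl.
apply: lerD; first by apply: ler_pM; rewrite ?cnorm_ge0.
apply: lerD; apply: ler_pM; rewrite ?mulr_ge0 ?cnorm_ge0//.
by rewrite ler_wpM2r ?cnorm_ge0.
Qed.

Lemma is_cderiv_invB p z : z != p ->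
  exists c, is_cderiv (fun w => cinv (csub w p)) z c.
Proof.
move=> zp; set k := fun w => cinv (csub w p).
have zp0 : csub z p != (0, 0) by rewrite csub_eq0.
set r := cnorm (csub z p); have r0 : 0 < r by rewrite cnorm_gt0.
exists (csub (0, 0) (cmul (k z) (k z))) => e e0.
(* For |h| < r / 2 the point [w] stays at distance at least r / 2 from [p]; the error |h|^2 / (|w -
   p| r^2) is then at most 2 |h|^2 / r^3. *)
exists (Num.min (r / 2) (e * r ^+ 3 / 2)).
  by rewrite lt_min !divr_gt0// mulr_gt0// exprn_gt0.
move=> h; rewrite lt_min => /andP[hr he]; set w := cadd z h.
have wr : r / 2 <= cnorm (csub w p).
  have := le_csubl (csub z p) (csub w p); rewrite -/r.
  have -> : csub (csub z p) (csub w p) = csub (0, 0) h by congr pair => /=; ring.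
  by rewrite cnormN; lra.
have wp0 : csub w p != (0, 0) by rewrite -cnorm_gt0; lra.
have kz : cmul (csub z p) (k z) = (1, 0) by exact: cmulV.
have kw : cmul (csub w p) (k w) = (1, 0) by exact: cmulV.
have E : csub (k w) (k z) = csub (0, 0) (cmul h (cmul (k w) (k z))).
  have one a : cmul (1, 0) a = a by case: a => ? ?; congr pair => /=; ring.
  rewrite -[in LHS](one (k w)) -kz -[in X in csub _ X](one (k z)) -kw.
  by congr pair => /=; ring.
have -> : csub (csub (k w) (k z)) (cmul (csub (0, 0) (cmul (k z) (k z))) h) =
   cmul (cmul h (k z)) (csub (k z) (k w)).
  by rewrite E; congr pair => /=; ring.
rewrite cnormM [cnorm (csub (k z) _)]cnormBC E cnormN.
rewrite !cnormM !cnormV -/r [leRHS]mulrC -[leLHS]mulrA.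
apply: ler_wpM2l; rewrite ?cnorm_ge0//.
have : (cnorm (csub w p))^-1 <= (r / 2)^-1 by rewrite lef_pV2 ?posrE ?divr_gt0// cnorm_gt0.
move=> Hw.
have : cnorm h * ((cnorm (csub w p))^-1 * (r^-1 * r^-1)) <= (e * r ^+ 3 / 2) * ((r / 2)^-1 * (r^-1 * r^-1)).
  apply: ler_pM; rewrite ?mulr_ge0 ?invr_ge0 ?cnorm_ge0 ?(ltW r0) ?(ltW he)//.
  by rewrite ler_wpM2r// mulr_ge0 ?invr_ge0 ?(ltW r0).
have -> : (e * r ^+ 3 / 2) * ((r / 2)^-1 * (r^-1 * r^-1)) = e by field; rewrite gt_eqF.
by apply: le_trans; rewrite le_eqVlt; apply/orP; left; apply/eqP; ring.
Qed.

End ComplexPlane.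

(** * Goursat's theorem for squares *)

Section Bisection.
Variable R : realType.

Lemma exists_half_expn_lt (s d : R) : 0 < d -> exists n, s / 2 ^+ n < d.
Proof.
move=> d0; exists (Num.truncn (s / d)).+1.
rewrite ltr_pdivrMr ?exprn_gt0// mulrC -ltr_pdivrMr//.
apply: (lt_trans (truncnS_gt _)).
by rewrite -natrX ltr_nat ltn_expl.
Qed.

Definition subsquare (x0 y0 s0 x y s : R) :=
  [/\ 0 < s, x0 <= x, y0 <= y, x + s <= x0 + s0 & y + s <= y0 + s0].

(* Along a nested sequence of quarters carrying at least a quarter of [N], [N] decays at most
   like the area, which contradicts the infinitesimal bound at the limit point. *)
Lemma square_bisection (N : R -> R -> R -> R) (x0 y0 s0 : R) : 0 < s0 ->
  (forall x y s, subsquare x0 y0 s0 x y s ->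
    N x y s <= N x y (s / 2) + N (x + s / 2) y (s / 2) +
               N x (y + s / 2) (s / 2) + N (x + s / 2) (y + s / 2) (s / 2)) ->
  (forall a b, x0 <= a <= x0 + s0 -> y0 <= b <= y0 + s0 ->
    forall e : R, 0 < e -> exists2 d : R, 0 < d & forall x y s, subsquare x0 y0 s0 x y s ->
      s < d -> x <= a <= x + s -> y <= b <= y + s -> N x y s <= e * s ^+ 2) ->
  N x0 y0 s0 <= 0.
Proof.
move=> s00 Nsub Nloc; rewrite leNgt; apply/negP => N0.
pose c := N x0 y0 s0 / s0 ^+ 2.
have c0 : 0 < c by rewrite divr_gt0// exprn_gt0.
pose quarter (z : R * R * R) (ij : bool * bool) : R * R * R :=
  (z.1.1 + ij.1%:R * (z.2 / 2), z.1.2 + ij.2%:R * (z.2 / 2), z.2 / 2).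
pose heavy (z : R * R * R) := c * z.2 ^+ 2 <= N z.1.1 z.1.2 z.2.
(* The default quarter is never reached from an [ok] square: by [Nsub], four quarters that are not
   heavy would make the square itself not heavy. *)
pose next z := quarter z (odflt (false, false) [pick ij | heavy (quarter z ij)]).
pose ok z := subsquare x0 y0 s0 z.1.1 z.1.2 z.2 /\ heavy z.
have nextP z : ok z -> [/\ ok (next z),
    z.1.1 <= (next z).1.1, (next z).1.1 + (next z).2 <= z.1.1 + z.2,
    z.1.2 <= (next z).1.2 & (next z).1.2 + (next z).2 <= z.1.2 + z.2].
  case: z => [[x y] s] [sq hz]; rewrite /next; case: pickP => [ij hij|nh] /=.
    case: sq => /= spos H1 H2 H3 H4.
    have s2 : 0 < s / 2 by rewrite divr_gt0.
    have hi : 0 <= (ij.1%:R : R) <= 1 by case: ij.1; rewrite /= ?lexx ?ler01.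
    have hj : 0 <= (ij.2%:R : R) <= 1 by case: ij.2; rewrite /= ?lexx ?ler01.
    have [i0 i1] : 0 <= ij.1%:R * (s / 2) /\ ij.1%:R * (s / 2) <= s / 2 by split; nra.
    have [j0 j1] : 0 <= ij.2%:R * (s / 2) /\ ij.2%:R * (s / 2) <= s / 2 by split; nra.
    by split => //; try split => //=; try split => /=; lra.
  exfalso; have := Nsub _ _ _ sq => /=.
  have h (i j : bool) : N (x + i%:R * (s / 2)) (y + j%:R * (s / 2)) (s / 2) < c * (s / 2) ^+ 2.
    by have := nh (i, j); rewrite /heavy /= => /negbT; rewrite -ltNge.
  have := h false false; have := h true false; have := h false true; have := h true true.
  move: hz; rewrite /heavy /= !mul0r !mul1r !addr0; lra.
pose u n := iter n next (x0, y0, s0).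
have u0 : ok (u 0).
  split; first by split.
  by rewrite /heavy /= /c divfK// expf_neq0// gt_eqF.
have uok n : ok (u n) by elim: n => // n /nextP[].
have us n : (u n).2 = s0 / 2 ^+ n.
  elim: n => [|n IH]; first by rewrite expr0 divr1.
  by rewrite /= IH exprSr invfM mulrA.
have ux n m : (n <= m)%N -> [/\ (u n).1.1 <= (u m).1.1,
    (u m).1.1 + (u m).2 <= (u n).1.1 + (u n).2, (u n).1.2 <= (u m).1.2 &
    (u m).1.2 + (u m).2 <= (u n).1.2 + (u n).2].
  elim: m => [|m IH]; first by rewrite leqn0 => /eqP ->; split.
  rewrite leq_eqVlt => /predU1P[->|]; first by split.
  rewrite ltnS => /IH[H1 H2 H3 H4]; have [_ G1 G2 G3 G4] := nextP _ (uok m).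
  by split; [exact: le_trans G1|exact: le_trans H2|exact: le_trans G3|exact: le_trans H4].
(* Nested intervals: the supremum of the left ends lies in all of them. *)
have lim (f : R * R * R -> R) :
    (forall n m, (n <= m)%N -> f (u n) <= f (u m) /\ f (u m) + (u m).2 <= f (u n) + (u n).2) ->
    exists a, forall n, f (u n) <= a <= f (u n) + (u n).2.
  move=> fu; exists (sup (range (f \o u))) => n.
  have ub m : f (u m) <= f (u n) + (u n).2.
    have sp k : 0 < (u k).2 by case: (uok k) => -[].
    have [mn|/ltnW nm] := leqP m n.
      by have [+ _] := fu _ _ mn; have := sp n; lra.
    by have [_] := fu _ _ nm; have := sp m; lra.
  apply/andP; split.
    apply: ub_le_sup; last by exists n.
    by exists (f (u n) + (u n).2) => _ [m _ <-]; exact: ub.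
  by apply: ge_sup; [exists (f (u n)), n | move=> _ [m _ <-]; exact: ub].
have [a aP] := lim (fun z => z.1.1) (fun n m nm => let: And4 H1 H2 _ _ := ux n m nm in conj H1 H2).
have [b bP] := lim (fun z => z.1.2) (fun n m nm => let: And4 _ _ H1 H2 := ux n m nm in conj H1 H2).
(* Heavy squares satisfy [N >= c * s ^+ 2], so the local bound with [c / 2] is contradictory. *)
have c2 : 0 < c / 2 by rewrite divr_gt0.
have [d d0 dP] := Nloc a b (aP 0) (bP 0) _ c2.
have [n nd] := exists_half_expn_lt s0 d0.
have [sq] := uok n; rewrite /heavy.
rewrite -us in nd.
have := dP _ _ _ sq nd (aP n) (bP n).
have : 0 < c / 2 * (u n).2 ^+ 2 by rewrite mulr_gt0// exprn_gt0// us divr_gt0// exprn_gt0.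
lra.
Qed.

End Bisection.

Section Goursat.
Variable R : realType.
Implicit Types (g : R * R -> R * R) (p z : R * R).
Notation mu := (@lebesgue_measure R).

Lemma segment_integrable (f : R -> R) (a b : R) :
  {within `[a, b], continuous f} -> mu.-integrable `[a, b] (EFin \o f).
Proof. by move=> cf; apply: continuous_compact_integrable => //; exact: segment_compact. Qed.

Lemma Rintegral_segment_cat (f : R -> R) (a b c : R) : a <= b -> b <= c ->
  {within `[a, c], continuous f} ->
  \int[mu]_(t in `[a, c]) f t = \int[mu]_(t in `[a, b]) f t + \int[mu]_(t in `[b, c]) f t.
Proof.
move=> ab bc cf; have fi := segment_integrable cf.
have := @Rintegral_itvB _ f (BLeft a) (BRight c) b fi.
rewrite !bnd_simp => /(_ ab bc) E.
rewrite [in RHS]addrC -(Rintegral_itv_obnd_cbnd (r := b)) -?E ?subrK//.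
by apply: integrableS fi => //; apply: subset_itvr; rewrite bnd_simp.
Qed.

Lemma Rintegral_segmentB (f g : R -> R) (a b : R) :
  {within `[a, b], continuous f} -> {within `[a, b], continuous g} ->
  \int[mu]_(t in `[a, b]) (f t - g t) =
  \int[mu]_(t in `[a, b]) f t - \int[mu]_(t in `[a, b]) g t.
Proof. by move=> cf cg; rewrite RintegralB//; exact: segment_integrable. Qed.

Lemma Rintegral_segment_cst (k a b : R) : a <= b ->
  \int[mu]_(t in `[a, b]) k = k * (b - a).
Proof.
move=> ab; rewrite Rintegral_cst//= lebesgue_measure_itv/= lte_fin.
by case: ltgtP ab => //= -> _; rewrite subrr.
Qed.

Lemma Rintegral_segment_bound (f : R -> R) (a b k M : R) : a <= b ->
  {within `[a, b], continuous f} -> (forall t, a <= t <= b -> `|f t - k| <= M) ->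
  `|\int[mu]_(t in `[a, b]) f t - k * (b - a)| <= M * (b - a).
Proof.
move=> ab cf fM; rewrite -!Rintegral_segment_cst// -Rintegral_segmentB//; last first.
  by apply: continuous_subspaceT => ?; exact: cvg_cst.
have ck : {within `[a, b], continuous (fun t => f t - k)}.
  by move=> x; apply: (cvgB (cf x)); exact: cvg_cst.
apply: (le_trans (le_normr_Rintegral _ (segment_integrable ck))) => //.
apply: le_Rintegral => //.
- have : {within `[a, b], continuous (fun t => `|f t - k|)}.
    by move=> x; apply: cvg_norm; exact: ck.
  exact: segment_integrable.
- by apply: segment_integrable; apply: continuous_subspaceT => ?; exact: cvg_cst.
Qed.

Definition continuous_above g := forall z, 0 < z.2 -> ccontinuous_at g z.

Lemma cnorm_horizontal (t : R) : cnorm (t, 0) = `|t|.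
Proof. by rewrite /cnorm/= expr0n addr0 sqrtr_sqr. Qed.

Lemma cnorm_vertical (t : R) : cnorm (0, t) = `|t|.
Proof. by rewrite /cnorm/= expr0n add0r sqrtr_sqr. Qed.

Lemma continuous_horizontal g (phi : R * R -> R) (y : R) : 0 < y ->
  (forall a b, `|phi a - phi b| <= cnorm (csub a b)) ->
  continuous_above g -> continuous (fun t => phi (g (t, y))).
Proof.
move=> y0 phil cg t; apply/cvgrPdist_le => e e0.
have [d d0 dP] := cg (t, y) y0 e e0.
near=> u; apply: (le_trans (phil _ _)); rewrite cnormBC.
have -> : (u, y) = cadd (t, y) (u - t, 0) by congr pair => /=; ring.
apply: dP; rewrite cnorm_horizontal distrC; near: u.
by apply/nbhs_ballP; exists d.
Unshelve. all: by end_near. Qed.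

Lemma continuous_vertical g (phi : R * R -> R) (x t : R) : 0 < t ->
  (forall a b, `|phi a - phi b| <= cnorm (csub a b)) ->
  continuous_above g -> {for t, continuous (fun t => phi (g (x, t)))}.
Proof.
move=> t0 phil cg; apply/cvgrPdist_le => e e0.
have [d d0 dP] := cg (x, t) t0 e e0.
near=> u; apply: (le_trans (phil _ _)); rewrite cnormBC.
have -> : (x, u) = cadd (x, t) (0, u - t) by congr pair => /=; ring.
apply: dP; rewrite cnorm_vertical distrC; near: u.
by apply/nbhs_ballP; exists d.
Unshelve. all: by end_near. Qed.

Lemma within_horizontal g (phi : R * R -> R) (y a b : R) : 0 < y ->
  (forall a b, `|phi a - phi b| <= cnorm (csub a b)) ->
  continuous_above g -> {within `[a, b], continuous (fun t => phi (g (t, y)))}.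
Proof.
move=> y0 phil cg; apply: continuous_subspaceT => t.
exact: (continuous_horizontal y0 phil cg).
Qed.

Lemma within_vertical g (phi : R * R -> R) (x a b : R) : 0 < a ->
  (forall a b, `|phi a - phi b| <= cnorm (csub a b)) ->
  continuous_above g -> {within `[a, b], continuous (fun t => phi (g (x, t)))}.
Proof.
move=> a0 phil cg; apply: continuous_in_subspaceT => t.
rewrite inE/= in_itv/= => /andP[at_ _].
exact: (@continuous_vertical g phi x t (lt_le_trans a0 at_)).
Qed.

Lemma fst_lipschitz (a b : R * R) : `|a.1 - b.1| <= cnorm (csub a b).
Proof. exact: (normr_fst_le (csub a b)). Qed.

Lemma snd_lipschitz (a b : R * R) : `|a.2 - b.2| <= cnorm (csub a b).
Proof. exact: (normr_snd_le (csub a b)). Qed.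

(* The imaginary part of the integral of [g(z) dz] along the boundary of the square with
   lower left corner [(x, y)] and side [s], counterclockwise. *)
Definition im_contour g (x y s : R) : R :=
  \int[mu]_(t in `[x, x + s]) ((g (t, y)).2 - (g (t, y + s)).2) +
  \int[mu]_(t in `[y, y + s]) ((g (x + s, t)).1 - (g (x, t)).1).

Lemma im_contourE g (x y s : R) : continuous_above g -> 0 < y -> 0 < s ->
  im_contour g x y s =
  \int[mu]_(t in `[x, x + s]) (g (t, y)).2 - \int[mu]_(t in `[x, x + s]) (g (t, y + s)).2 +
  (\int[mu]_(t in `[y, y + s]) (g (x + s, t)).1 - \int[mu]_(t in `[y, y + s]) (g (x, t)).1).
Proof.
move=> cg y0 s0; have ys : 0 < y + s by rewrite addr_gt0.
by rewrite /im_contour !Rintegral_segmentB//; (apply: (within_horizontal (phi := snd)) ||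
  apply: (within_vertical (phi := fst))) => //; (exact: fst_lipschitz || exact: snd_lipschitz).
Qed.

Lemma im_contour_quarters g (x y s : R) : continuous_above g -> 0 < y -> 0 < s ->
  im_contour g x y s =
  im_contour g x y (s / 2) + im_contour g (x + s / 2) y (s / 2) +
  im_contour g x (y + s / 2) (s / 2) + im_contour g (x + s / 2) (y + s / 2) (s / 2).
Proof.
move=> cg y0 s0; have h0 : 0 < s / 2 by rewrite divr_gt0.
have yh0 : 0 < y + s / 2 by rewrite addr_gt0.
have ys0 : 0 < y + s by rewrite addr_gt0.
have xE : x + s / 2 + s / 2 = x + s by lra.
have yE : y + s / 2 + s / 2 = y + s by lra.
rewrite !im_contourE// !xE !yE.
have H b : 0 < b -> \int[mu]_(t in `[x, x + s]) (g (t, b)).2 =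
    \int[mu]_(t in `[x, (x + s / 2)]) (g (t, b)).2 +
    \int[mu]_(t in `[(x + s / 2), x + s]) (g (t, b)).2.
  move=> b0; apply: Rintegral_segment_cat; [lra|lra|].
  by apply: (within_horizontal (phi := snd)) => //; exact: snd_lipschitz.
have V a : \int[mu]_(t in `[y, y + s]) (g (a, t)).1 =
    \int[mu]_(t in `[y, (y + s / 2)]) (g (a, t)).1 +
    \int[mu]_(t in `[(y + s / 2), y + s]) (g (a, t)).1.
  apply: Rintegral_segment_cat; [lra|lra|].
  by apply: (within_vertical (phi := fst)) => //; exact: fst_lipschitz.
rewrite !H// !V; ring.
Qed.

(** The number [k] is subtracted on one pair of opposite sides and added on the other, so it cancels
    in the contour integral. It stands for the linear part of [g]. *)
Lemma im_contour_bound g (x y s k M : R) : continuous_above g -> 0 < y -> 0 < s ->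
  (forall t, x <= t <= x + s -> `|(g (t, y)).2 - (g (t, y + s)).2 + k| <= M) ->
  (forall t, y <= t <= y + s -> `|(g (x + s, t)).1 - (g (x, t)).1 - k| <= M) ->
  `|im_contour g x y s| <= 2 * M * s.
Proof.
move=> cg y0 s0 hM vM.
have ys0 : 0 < y + s by rewrite addr_gt0.
have ch : {within `[x, x + s], continuous (fun t => (g (t, y)).2 - (g (t, y + s)).2)}.
  by move=> t; apply: cvgB; apply: (within_horizontal (phi := snd)) => //; exact: snd_lipschitz.
have cv : {within `[y, y + s], continuous (fun t => (g (x + s, t)).1 - (g (x, t)).1)}.
  by move=> t; apply: cvgB; apply: (within_vertical (phi := fst)) => //; exact: fst_lipschitz.
have := @Rintegral_segment_bound _ x (x + s) (- k) M ltac:(lra) ch.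
have := @Rintegral_segment_bound _ y (y + s) k M ltac:(lra) cv.
rewrite /im_contour; set A := \int[mu]_(t in _) _; set B := \int[mu]_(t in _) _.
move=> /(_ vM) + /(_ ltac:(by move=> t /hM; rewrite opprK)).
have -> : y + s - y = s by ring.
have -> : x + s - x = s by ring.
rewrite !ler_norml; lra.
Qed.

Lemma cnorm_square (x y s a b t u : R) : x <= a <= x + s -> y <= b <= y + s ->
  x <= t <= x + s -> y <= u <= y + s -> cnorm (csub (t, u) (a, b)) <= 2 * s.
Proof.
move=> xa yb xt yu; apply: (le_trans (cnorm_le_normD _)) => /=.
have : `|t - a| <= s by rewrite ler_norml; lra.
have : `|u - b| <= s by rewrite ler_norml; lra.
lra.
Qed.

Lemma im_contour_littleo g p c : continuous_above g -> is_cderiv g p c ->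
  forall e : R, 0 < e -> exists2 d : R, 0 < d & forall x y s, 0 < y -> 0 < s < d ->
    x <= p.1 <= x + s -> y <= p.2 <= y + s -> `|im_contour g x y s| <= e * s ^+ 2.
Proof.
(* Points of the square are within 2 s of [p], so the Taylor error is at most e / 4 * s at each
   point and e / 2 * s for two opposite sides; [im_contour_bound] doubles this once more. *)
move=> cg gc e e0; have [d d0 dP] := gc (e / 8) ltac:(by rewrite divr_gt0).
exists (d / 2); first by rewrite divr_gt0.
move=> x y s y0 /andP[s0 sd] xp yp.
have E t u : x <= t <= x + s -> y <= u <= y + s ->
    cnorm (csub (csub (g (t, u)) (g p)) (cmul c (csub (t, u) p))) <= e / 4 * s.
  move=> xt yu; have h2 : cnorm (csub (t, u) p) <= 2 * s.
    by rewrite [p]surjective_pairing; exact: cnorm_square xp yp xt yu.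
  have := dP (csub (t, u) p) ltac:(by lra); rewrite caddK => /le_trans; apply.
  by rewrite (_ : e / 4 * s = e / 8 * (2 * s)) ?ler_wpM2l//; [rewrite divr_ge0// ltW|field].
have -> : e * s ^+ 2 = 2 * (e / 2 * s) * s by field.
apply: (im_contour_bound (k := c.1 * s)) => // t ht.
- have := E t y ht ltac:(lra); have := E t (y + s) ht ltac:(lra).
  move=> /(le_trans (normr_snd_le _)) + /(le_trans (normr_snd_le _)).
  rewrite /cmul /csub /= !ler_norml; lra.
- have := E x t ltac:(lra) ht; have := E (x + s) t ltac:(lra) ht.
  move=> /(le_trans (normr_fst_le _)) + /(le_trans (normr_fst_le _)).
  rewrite /cmul /csub /= !ler_norml; lra.
Qed.

Lemma goursat_square g x0 y0 s0 : continuous_above g -> 0 < y0 -> 0 < s0 ->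
  (forall p, x0 <= p.1 <= x0 + s0 -> y0 <= p.2 <= y0 + s0 -> exists c, is_cderiv g p c) ->
  im_contour g x0 y0 s0 = 0.
Proof.
move=> cg y00 s00 gd; apply/eqP; rewrite -normr_le0.
apply: (@square_bisection _ (fun x y s => `|im_contour g x y s|)) => //.
- move=> x y s [sp _ yy _ _]; rewrite (im_contour_quarters x cg (lt_le_trans y00 yy) sp).
  by do 3 (apply: (le_trans (ler_normD _ _)); apply: lerD => //).
- move=> a b xa yb e e0; have [c gc] := gd (a, b) xa yb.
  have [d d0 dP] := im_contour_littleo cg gc e0; exists d => //.
  by move=> x y s [sp _ yy _ _] sd xas ybs; apply: dP; rewrite ?sp// (lt_le_trans y00 yy).
Qed.

(* An isolated point where [g] is merely continuous is harmless: squares having it as a corner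
   can be halved repeatedly without changing the contour integral. *)
Lemma goursat_square_center g p (r : R) : continuous_above g -> 0 < r < p.2 ->
  (forall z, 0 < z.2 -> z != p -> exists c, is_cderiv g z c) ->
  im_contour g (p.1 - r) (p.2 - r) (r + r) = 0.
Proof.
move=> cg /andP[r0 rp] gd.
(* The booleans tell whether the square lies to the left of [p] and below [p]. *)
pose corner (i j : bool) (s : R) := im_contour g (p.1 - i%:R * s) (p.2 - j%:R * s) s.
(* Three of the four quarters miss [p] and contribute 0 by [goursat_square]; the fourth is again a
   corner square. *)
have cornerE i j s : 0 < s < p.2 -> corner i j s = corner i j (s / 2).
  move=> /andP[s0 sp]; have h0 : 0 < s / 2 by rewrite divr_gt0.
  have other x y : 0 < y -> ~~ ((x <= p.1 <= x + s / 2) && (y <= p.2 <= y + s / 2)) ->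
      im_contour g x y (s / 2) = 0.
    move=> y0 np; apply: goursat_square => // z zx zy; apply: gd.
      by case/andP: zy => [yz _]; exact: lt_le_trans yz.
    by apply: contra np => /eqP <-; rewrite zx zy.
  rewrite /corner im_contour_quarters//; last by case: (j) => /=; lra.
  have hE (u : R) : u - s + s / 2 = u - s / 2 by field.
  case: i j => -[] /=; rewrite ?mul1r ?mul0r ?subr0.
  - rewrite !(other (p.1 - s), other _ (p.2 - s)) ?add0r//; try lra.
    by rewrite !hE.
  - rewrite [X in _ + X](other _ (p.2 + s / 2)) ?(other (p.1 - s)) ?addr0 ?add0r//; try lra.
    by rewrite !hE.
  - rewrite [X in _ + X](other (p.1 + s / 2)) ?(other _ (p.2 - s)) ?addr0 ?add0r//; try lra.
    by rewrite !hE.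
  - rewrite [X in _ + X](other (p.1 + s / 2)) ?(other (p.1 + s / 2)) ?(other _ (p.2 + s / 2));
      rewrite ?addr0//; lra.
have cornerX i j s n : 0 < s < p.2 -> corner i j s = corner i j (s / 2 ^+ n).
  move=> sp; elim: n => [|n ->]; first by rewrite expr0 divr1.
  rewrite cornerE; first by rewrite exprSr invfM mulrA.
  have h1 : 1 <= (2 : R) ^+ n by rewrite exprn_ege1// ler1n.
  case/andP: sp => s0 sp; rewrite divr_gt0 ?exprn_gt0//=; apply: le_lt_trans sp.
  by rewrite ler_pdivrMr ?exprn_gt0// ler_peMr// ltW.
have p0 : 0 < p.2 by lra.
have [d d0 dP] := cg p p0 1 ltr01.
set M := cnorm (g p) + 1; have M0 : 0 < M by have := cnorm_ge0 (g p); rewrite /M; lra.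
have gM z : cnorm (csub z p) < d -> cnorm (g z) <= M.
  move=> /dP; rewrite caddK => h; have := le_csubl (g z) (g p); rewrite /M; lra.
(* Perimeter times a local bound of |g|; this tends to 0 under halving. *)
have corner_bound i j s : 0 < s -> s < p.2 -> 2 * s < d -> `|corner i j s| <= 4 * M * s.
  move=> s0 sp sd; rewrite (_ : 4 * M = 2 * (2 * M)); last by ring.
  have ij (b : bool) : 0 <= b%:R * s <= s by case: b; rewrite /= ?mul1r ?mul0r lexx ltW.
  have /andP[hi hi'] := ij i; have /andP[hj hj'] := ij j.
  have B t u : p.1 - i%:R * s <= t <= p.1 - i%:R * s + s ->
      p.2 - j%:R * s <= u <= p.2 - j%:R * s + s -> cnorm (g (t, u)) <= M.
    move=> ht hu; apply: gM; apply: le_lt_trans sd; rewrite [p]surjective_pairing.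
    by apply: cnorm_square ht hu; rewrite /=; lra.
  apply: (im_contour_bound (k := 0)) => //; first lra.
  - move=> t ht; rewrite addr0 (le_trans (ler_normB _ _))// [leRHS]mulr_natl [leRHS]mulr2n.
    by apply: lerD; apply: (le_trans (normr_snd_le _)); apply: B; lra.
  - move=> t ht; rewrite subr0 (le_trans (ler_normB _ _))// [leRHS]mulr_natl [leRHS]mulr2n.
    by apply: lerD; apply: (le_trans (normr_fst_le _)); apply: B; lra.
have corner0 i j s : 0 < s < p.2 -> corner i j s = 0.
  move=> sp; apply/eqP; rewrite -normr_le0 leNgt; apply/negP => c0.
  have m0 : 0 < Num.min (Num.min (d / 2) p.2) (`|corner i j s| / (4 * M)).
    by rewrite !lt_min p0 divr_gt0//= divr_gt0// mulr_gt0.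
  have [n] := exists_half_expn_lt s m0.
  rewrite !lt_min => /andP[/andP[n1 n2] n3].
  have := corner_bound i j (s / 2 ^+ n).
  rewrite -cornerX// => /(_ ltac:(by case/andP: sp => s0 _; rewrite divr_gt0 ?exprn_gt0)).
  move=> /(_ n2 ltac:(lra)); apply/negP; rewrite -ltNge mulrC -ltr_pdivlMr//.
  by rewrite mulr_gt0.
have rE : (r + r) / 2 = r by field.
have r1 : 0 < r < p.2 by lra.
rewrite im_contour_quarters ?rE//; [|lra|lra].
rewrite !subrK.
have := corner0 false false r r1; have := corner0 true false r r1.
have := corner0 false true r r1; have := corner0 true true r r1.
rewrite /corner /= !mul1r !mul0r !subr0 => -> -> -> ->; ring.
Qed.

End Goursat.

(** * Mean value over the sides of a square *)

Section SideMean.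
Variable R : realType.
Implicit Types (f : R * R -> R * R) (p w u : R * R).
Notation mu := (@lebesgue_measure R).

Lemma cnorm_lipschitz (a b : R * R) : `|cnorm a - cnorm b| <= cnorm (csub a b).
Proof.
have := le_csubl a b; have := le_csubl b a; rewrite (cnormBC b a) ler_norml; lra.
Qed.

Lemma holomorphic_continuous_above f : holomorphic_on (@Cplus R) f -> continuous_above f.
Proof. by move=> /holomorphic_onP hf z /hf[c]; exact: is_cderiv_continuous. Qed.

Definition conjc (a : R * R) : R * R := (a.1, - a.2).

(** Multiplying by [conjc (f p)] makes the coefficient of 1 / (w - p) real, so that the imaginary
    part of the contour integral alone recovers |f p|. With [c] the derivative, the value at [p] is
    the continuous extension. *)
Definition difference_quotient f p c w :=
  cmul (conjc (f p)) (if w == p then c else cmul (csub (f w) (f p)) (cinv (csub w p))).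

Lemma is_cderiv_difference_quotient f p c w : w != p ->
  (exists d, is_cderiv f w d) -> exists d, is_cderiv (difference_quotient f p c) w d.
Proof.
move=> wp [d fd]; have [d' kd] := is_cderiv_invB wp.
have dq := is_cderivM (is_cderiv_cst (conjc (f p)) w)
  (is_cderivM (@is_cderiv_subc _ f w d (f p) fd) kd).
eexists; apply: (is_cderiv_near (r := cnorm (csub p w))) dq.
  by rewrite cnorm_gt0 csub_eq0 eq_sym.
move=> h hr; rewrite /difference_quotient ifN//.
by apply: contraTneq hr => <-; rewrite csubK ltxx.
Qed.

Lemma continuous_difference_quotient f p c : is_cderiv f p c ->
  (forall w, 0 < w.2 -> exists d, is_cderiv f w d) ->
  continuous_above (difference_quotient f p c).
Proof.
move=> fc fd w w0; have [->|wp] := eqVneq w p; last first.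
  by have [d] := is_cderiv_difference_quotient c wp (fd w w0); exact: is_cderiv_continuous.
move=> e e0; set K := cnorm (f p) + 1.
have K0 : 0 < K by have := cnorm_ge0 (f p); rewrite /K; lra.
have [d d0 dP] := fc (e / K) ltac:(by rewrite divr_gt0).
exists d => // h /dP H; rewrite /difference_quotient eqxx.
have eE : e = K * (e / K) by field; rewrite gt_eqF.
case: eqP => [_|/eqP hp].
  by rewrite (_ : csub _ _ = (0, 0)) ?cnorm0 ?(ltW e0)//; congr pair => /=; ring.
rewrite -cmulBr cnormM eE; apply: ler_pM; rewrite ?cnorm_ge0//.
  rewrite (_ : cnorm (conjc _) = cnorm (f p)) ?lerDl//.
  by rewrite /cnorm /= sqrrN.
have h0 : h != (0, 0) by apply: contra hp => /eqP ->; rewrite cadd0.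
have hK : cmul h (cinv h) = (1, 0) by exact: cmulV.
rewrite csubK (_ : csub _ c = cmul (csub (csub (f (cadd p h)) (f p)) (cmul c h)) (cinv h)).
  by rewrite cnormM cnormV ler_pdivrMr// cnorm_gt0.
have one (a : R * R) : cmul a (1, 0) = a by case: a => ? ?; congr pair => /=; ring.
by rewrite -[in LHS](one c) -hK; congr pair => /=; ring.
Qed.

Section pointwise.
Variables (f : R * R -> R * R) (p : R * R) (c : R * R) (s : R) (w : R * R).
Hypotheses (s0 : 0 < s) (w1 : `|w.1 - p.1| <= s) (w2 : `|w.2 - p.2| <= s).
Let F := cnorm (f p).
Let bound := F / s * cnorm (f w) - F ^+ 2 / (2 * s).

(** Here [(j, i)] is the outward unit normal of the side through [w], and the left-hand side is the
    integrand of [im_contour] there. On the boundary s <= |w - p|, which bounds the term with [f w],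
    and |w - p|^2 <= 2 s^2, so the pole term F^2 s / |w - p|^2 is at least F^2 / (2 s). *)
Let estimate (i j : R) : i ^+ 2 + j ^+ 2 = 1 ->
  i * (w.2 - p.2) + j * (w.1 - p.1) = s ->
  j * (difference_quotient f p c w).1 - i * (difference_quotient f p c w).2 <= bound.
Proof.
move=> ij1 ijs; set u := csub w p.
have u1 : i * u.2 + j * u.1 = s by [].
set rho := u.1 ^+ 2 + u.2 ^+ 2.
have rhos : s ^+ 2 <= rho.
  rewrite -u1 /rho; have := sqr_ge0 (i * u.1 - j * u.2).
  have -> : u.1 ^+ 2 + u.2 ^+ 2 = (i ^+ 2 + j ^+ 2) * (u.1 ^+ 2 + u.2 ^+ 2).
    by rewrite ij1 mul1r.
  lra.
have rho2 : rho <= 2 * s ^+ 2.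
  have : u.1 ^+ 2 <= s ^+ 2 by rewrite -real_normK ?num_real// ler_sqr ?nnegrE// ltW.
  have : u.2 ^+ 2 <= s ^+ 2 by rewrite -real_normK ?num_real// ler_sqr ?nnegrE// ltW.
  rewrite /rho; lra.
have rho0 : 0 < rho by apply: lt_le_trans rhos; rewrite exprn_gt0.
have wp : w != p.
  by rewrite -csub_eq0 -cnorm_eq0 -[cnorm _ == 0](@expf_eq0 _ _ 2) sqr_cnorm gt_eqF.
set v := cmul (conjc (f p)) (cmul (f w) (cinv u)).
have -> : difference_quotient f p c w = csub v (cmul (F ^+ 2, 0) (cinv u)).
  rewrite /difference_quotient (negbTE wp) -/u /F sqr_cnorm.
  by congr pair => /=; ring.
have -> : j * (csub v (cmul (F ^+ 2, 0) (cinv u))).1 -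
          i * (csub v (cmul (F ^+ 2, 0) (cinv u))).2 =
    (cmul (j, i) v).1 - F ^+ 2 * s / rho.
  by rewrite /= -[in RHS]u1 /cinv/= -/rho; field; rewrite gt_eqF.
apply: lerB.
  apply: (le_trans (ler_norm _)); apply: (le_trans (normr_fst_le _)).
  rewrite !cnormM cnormV (_ : cnorm (j, i) = 1) ?mul1r; last first.
    by rewrite /cnorm /= addrC ij1 sqrtr1.
  rewrite (_ : cnorm (conjc _) = F); last by rewrite /F /cnorm /= sqrrN.
  rewrite mulrCA [leRHS]mulrC ler_wpM2l ?cnorm_ge0// ler_wpM2l ?cnorm_ge0//.
  have u0 : 0 < cnorm u by rewrite cnorm_gt0 csub_eq0.
  rewrite lef_pV2 ?posrE//.
  by rewrite -ler_sqr ?nnegrE ?cnorm_ge0 ?(ltW s0)// sqr_cnorm.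
rewrite -mulrA ler_wpM2l ?sqr_ge0// ler_pdivlMr// mulrC ler_pdivrMr ?mulr_gt0//.
by rewrite mulrCA -expr2.
Qed.

Lemma difference_quotient_bottom : w.2 - p.2 = - s -> (difference_quotient f p c w).2 <= bound.
Proof. by move=> E; have := @estimate (-1) 0; rewrite E; (do ![move=> /(_ ltac:(ring))]); lra. Qed.

Lemma difference_quotient_top : w.2 - p.2 = s -> - (difference_quotient f p c w).2 <= bound.
Proof. by move=> E; have := @estimate 1 0; rewrite E; (do ![move=> /(_ ltac:(ring))]); lra. Qed.

Lemma difference_quotient_right : w.1 - p.1 = s -> (difference_quotient f p c w).1 <= bound.
Proof. by move=> E; have := @estimate 0 1; rewrite E; (do ![move=> /(_ ltac:(ring))]); lra. Qed.

Lemma difference_quotient_left : w.1 - p.1 = - s -> - (difference_quotient f p c w).1 <= bound.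
Proof. by move=> E; have := @estimate 0 (-1); rewrite E; (do ![move=> /(_ ltac:(ring))]); lra. Qed.

End pointwise.

Lemma normr_shift (x s : R) : 0 < s -> `|x - s - x| <= s /\ `|x + s - x| <= s.
Proof.
move=> s0; have -> : x - s - x = - s by ring.
have -> : x + s - x = s by ring.
by rewrite normrN gtr0_norm.
Qed.

(* Cauchy's theorem for the difference quotient at [p], normalized so that the pole of
   [conj (f p) * f w / (w - p)] has residue [|f p|^2]; the integral of [dw / (w - p)] along the
   square, equal to [2 pi i], is only bounded below by [4]. *)
Lemma mean_value_square f p (s : R) : holomorphic_on (@Cplus R) f -> 0 < s < p.2 ->
  4 * s * cnorm (f p) <=
  \int[mu]_(t in `[p.1 - s, p.1 + s]) (cnorm (f (t, p.2 - s)) + cnorm (f (t, p.2 + s))) +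
  \int[mu]_(t in `[p.2 - s, p.2 + s]) (cnorm (f (p.1 + s, t)) + cnorm (f (p.1 - s, t))).
Proof.
move=> hf sp; have cf := holomorphic_continuous_above hf.
move: hf => /holomorphic_onP hf.
case/andP: (sp) => s0 ltsp; have p0 : 0 < p.2 by lra.
have [c fc] := hf p p0.
set g := difference_quotient f p c; set F := cnorm (f p).
have cg : continuous_above g by exact: continuous_difference_quotient.
have G := goursat_square_center cg sp
  (fun z z0 zp => is_cderiv_difference_quotient c zp (hf z z0)).
have E1 : p.1 - s + (s + s) = p.1 + s by ring.
have E2 : p.2 - s + (s + s) = p.2 + s by ring.
rewrite /im_contour E1 E2 in G.
have ym0 : 0 < p.2 - s by lra.
have yp0 : 0 < p.2 + s by lra.
set a := fun t => cnorm (f (t, p.2 - s)) + cnorm (f (t, p.2 + s)).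
set b := fun t => cnorm (f (p.1 + s, t)) + cnorm (f (p.1 - s, t)).
have ca : {within `[p.1 - s, p.1 + s], continuous a}.
  by move=> t; apply: cvgD; apply: (within_horizontal (phi := @cnorm R)) => //;
    exact: cnorm_lipschitz.
have cb : {within `[p.2 - s, p.2 + s], continuous b}.
  by move=> t; apply: cvgD; apply: (within_vertical (phi := @cnorm R)) => //;
    exact: cnorm_lipschitz.
have cc x y (k : R) : {within `[x, y], continuous (fun=> k)}.
  by apply: continuous_subspaceT => ?; exact: cvg_cst.
have intE x y (h : R -> R) : {within `[x, y], continuous h} -> x <= y -> y - x = 2 * s ->
    \int[mu]_(t in `[x, y]) (F / s * h t - F ^+ 2 / s) =
    F / s * \int[mu]_(t in `[x, y]) h t - 2 * F ^+ 2.
  move=> ch xy yx; rewrite Rintegral_segmentB//; last first.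
    by move=> t; apply: cvgM; [exact: cvg_cst|exact: ch].
  rewrite RintegralZl//; last exact: segment_integrable.
  by rewrite Rintegral_segment_cst// yx; field; rewrite gt_eqF.
have le_int x y (h k : R -> R) : {within `[x, y], continuous h} ->
    {within `[x, y], continuous k} -> x <= y -> y - x = 2 * s ->
    (forall t, x <= t <= y -> k t <= F / s * h t - F ^+ 2 / s) ->
    \int[mu]_(t in `[x, y]) k t <= F / s * \int[mu]_(t in `[x, y]) h t - 2 * F ^+ 2.
  move=> ch ck xy yx hk; rewrite -intE//; apply: le_Rintegral => //.
  - exact: segment_integrable.
  - apply: segment_integrable => t; apply: cvgB; last exact: cc.
    by apply: cvgM; [exact: cvg_cst|exact: ch].
have half : F ^+ 2 / s = F ^+ 2 / (2 * s) + F ^+ 2 / (2 * s) by field; rewrite gt_eqF.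
have H1 := @le_int _ _ a (fun t => (g (t, p.2 - s)).2 - (g (t, p.2 + s)).2) ca.
have H2 := @le_int _ _ b (fun t => (g (p.1 + s, t)).1 - (g (p.1 - s, t)).1) cb.
have {}H1 := H1 ltac:(by move=> t; apply: cvgB; apply: (within_horizontal (phi := snd)) => //;
  exact: snd_lipschitz) ltac:(lra) ltac:(by ring).
have {}H2 := H2 ltac:(by move=> t; apply: cvgB; apply: (within_vertical (phi := fst)) => //;
  exact: fst_lipschitz) ltac:(lra) ltac:(by ring).
have nn := fun x => normr_shift x s0.
have /H1 {}H1 : forall t, p.1 - s <= t <= p.1 + s ->
    (g (t, p.2 - s)).2 - (g (t, p.2 + s)).2 <= F / s * a t - F ^+ 2 / s.
  move=> t ht; have ts : `|t - p.1| <= s by rewrite ler_norml; lra.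
  have [n1 n2] := nn p.2.
  have := @difference_quotient_bottom f p c s (t, p.2 - s) s0 ts n1 ltac:(by rewrite /=; ring).
  have := @difference_quotient_top f p c s (t, p.2 + s) s0 ts n2 ltac:(by rewrite /=; ring).
  rewrite half /a -/g -/F; lra.
have /H2 {}H2 : forall t, p.2 - s <= t <= p.2 + s ->
    (g (p.1 + s, t)).1 - (g (p.1 - s, t)).1 <= F / s * b t - F ^+ 2 / s.
  move=> t ht; have ts : `|t - p.2| <= s by rewrite ler_norml; lra.
  have [n1 n2] := nn p.1.
  have := @difference_quotient_left f p c s (p.1 - s, t) s0 n1 ts ltac:(by rewrite /=; ring).
  have := @difference_quotient_right f p c s (p.1 + s, t) s0 n2 ts ltac:(by rewrite /=; ring).
  rewrite half /b -/g -/F; lra.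
set A := \int[mu]_(t in _) a t in H1 *; set B := \int[mu]_(t in _) b t in H2 *.
have AB : 0 <= A + B.
  by rewrite addr_ge0// Rintegral_ge0// => t _; rewrite addr_ge0 ?cnorm_ge0.
have [->|F0] := eqVneq F 0; first by rewrite mulr0.
have {F0}F0 : 0 < F by rewrite lt0r F0 cnorm_ge0.
(* The sum of the left-hand sides of [H1] and [H2] is the contour integral, which vanishes by
   [G]. *)
have H : 4 * F ^+ 2 <= F / s * (A + B) by move: H1 H2 G; lra.
have -> : 4 * s * F = (4 * F ^+ 2) / (F / s) by field; rewrite !gt_eqF.
by rewrite ler_pdivrMr ?divr_gt0// [leRHS]mulrC.
Qed.

End SideMean.

(** * Mean value over a square *)

Section AreaMean.
Variable R : realType.
Implicit Types (f : R * R -> R * R) (p w z : R * R).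
Notation mu := (@lebesgue_measure R).
Notation mu2 := ((@lebesgue_measure R \x @lebesgue_measure R)%E).

(** An open set is the union of the countably many rational boxes that it contains, and boxes belong
    to the product sigma-algebra. *)
Lemma measurable_cnorm_open (A : set (R * R)) :
  (forall z, A z -> exists2 d : R, 0 < d & forall w, cnorm (csub w z) < d -> A w) ->
  measurable A.
Proof.
move=> oA.
pose box (q : rat * rat * rat) : set (R * R) :=
  `]ratr q.1.1 - ratr q.2, ratr q.1.1 + ratr q.2[%classic `*`
  `]ratr q.1.2 - ratr q.2, ratr q.1.2 + ratr q.2[%classic.
have -> : A = \bigcup_q (if `[< box q `<=` A >] then box q else set0).
  apply/seteqP; split => [z Az|z [q _]]; last by case: asboolP => // h; exact: h.
  have [d d0 dP] := oA z Az.
  (* The rational centre is within [ratr q3] of [z] in each coordinate, so points of the box are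
     within [2 * ratr q3] in each, hence within [d] of [z]. *)
  have [q3] := @rat_in_itvoo R 0 (d / 4) ltac:(by rewrite divr_gt0).
  rewrite in_itv/= => /andP[q0 qd].
  have [q1] := @rat_in_itvoo R (z.1 - ratr q3) (z.1 + ratr q3) ltac:(lra).
  have [q2] := @rat_in_itvoo R (z.2 - ratr q3) (z.2 + ratr q3) ltac:(lra).
  rewrite !in_itv/= => h2 h1; exists (q1, q2, q3) => //.
  case: asboolP => [_|[]]; first by split; rewrite /= in_itv/=; lra.
  move=> w [] /=; rewrite !in_itv/= => w1 w2; apply: dP.
  apply: (le_lt_trans (cnorm_le_normD _)) => /=.
  have : `|w.1 - z.1| < 2 * ratr q3 by rewrite ltr_norml; lra.
  have : `|w.2 - z.2| < 2 * ratr q3 by rewrite ltr_norml; lra.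
  lra.
apply: countable_bigcupT_measurable => // q; case: ifP => // _.
by apply: measurableX; exact: measurable_itv.
Qed.

Lemma measurable_Cplus : measurable (@Cplus R).
Proof.
apply: measurable_cnorm_open => z z0; exists z.2 => // w.
move=> /(le_lt_trans (normr_snd_le _)); rewrite ltr_norml /Cplus /=; lra.
Qed.

Definition ccontinuous_fun_at (phi : R * R -> R) z := forall e : R, 0 < e ->
  exists2 d : R, 0 < d & forall w, cnorm (csub w z) < d -> `|phi w - phi z| <= e.

Lemma Cplus_superlevel_measurable (phi : R * R -> R) (x : R) :
  (forall z, 0 < z.2 -> ccontinuous_fun_at phi z) ->
  measurable [set z | Cplus z /\ x < phi z].
Proof.
move=> cphi; apply: measurable_cnorm_open => z [z0 xz].
have [d d0 dP] := cphi z z0 ((phi z - x) / 2) ltac:(by rewrite divr_gt0// subr_gt0).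
exists (Num.min d z.2); first by rewrite lt_min d0.
move=> w; rewrite lt_min => /andP[/dP + /(le_lt_trans (normr_snd_le _))].
rewrite ler_norml ltr_norml /Cplus /= => h1 h2; split; lra.
Qed.

Lemma ccontinuous_measurable_fun (phi : R * R -> R) :
  (forall z, 0 < z.2 -> ccontinuous_fun_at phi z) -> measurable_fun (@Cplus R) phi.
Proof.
move=> cphi mD; apply: (measurability _ (RGenOInfty.measurableE R)) => //.
move=> /= _ [_ [x ->] <-]; rewrite [X in measurable X](_ : _ = [set z | Cplus z /\ x < phi z]).
  exact: Cplus_superlevel_measurable.
by apply/seteqP; split => z [hz hx]; split => //; move: hx; rewrite /= in_itv/= andbT.
Qed.

Lemma ccontinuous_cnorm f z : ccontinuous_at f z -> ccontinuous_fun_at (fun w => cnorm (f w)) z.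
Proof.
move=> cf e /cf[d d0 dP]; exists d => // w /dP; rewrite caddK.
exact: le_trans (cnorm_lipschitz _ _).
Qed.

Lemma holomorphic_measurable_cnorm f : holomorphic_on (@Cplus R) f ->
  measurable_fun (@Cplus R) (fun z => cnorm (f z)).
Proof.
move=> /holomorphic_continuous_above cf; apply: ccontinuous_measurable_fun => z z0.
exact/ccontinuous_cnorm/cf.
Qed.

Lemma measurable_addl (c : R) : measurable_fun setT (fun x : R => c + x).
Proof. by apply: measurable_funD; [exact: measurable_cst|exact: measurable_id]. Qed.

Section translation.
Local Open Scope ereal_scope.

(** Uniqueness of Lebesgue measure reduces translation invariance to half-open intervals. *)
Lemma lebesgue_measure_addl (c : R) (A : set R) : measurable A ->
  pushforward mu (+%R c : _ -> measurableTypeR R) A = mu A.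
Proof.
move=> mA; apply/esym/lebesgue_measure_unique => //=; first exact: measurable_addl.
move=> _ _ [[a b] _ <-]; rewrite /pushforward /=.
have -> : +%R c @^-1` `]a, b] = `](a - c)%R, (b - c)%R]%classic.
  by apply/seteqP; split => x /=; rewrite !in_itv/= ltrBlDl lerBrDl.
rewrite !lebesgue_measure_itv/= !lte_fin ltrD2r; case: ifPn => // _.
by rewrite -!EFinB; congr EFin; ring.
Qed.

Lemma ge0_integral_addl (c : R) (h : R -> \bar R) : measurable_fun setT h ->
  (forall x, 0 <= h x) -> \int[mu]_x h (c + x)%R = \int[mu]_x h x.
Proof.
move=> mh h0.
rewrite -[LHS]/(\int[mu]_(x in (+%R c : _ -> measurableTypeR R) @^-1` setT) (h \o +%R c) x).
rewrite -ge0_integral_pushforward//=; last exact: measurable_addl.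
by apply: eq_measure_integral => //= [|? A mA _]; [exact: measurable_addl|exact: lebesgue_measure_addl].
Qed.

Lemma ge0_integral_subl (c : R) (h : R -> \bar R) : measurable_fun setT h ->
  (forall x, 0 <= h x) -> \int[mu]_x h (c - x)%R = \int[mu]_x h x.
Proof.
move=> mh h0; pose h' x := h (c + x)%R.
have mh' : measurable_fun setT h'.
  by apply: measurableT_comp => //; exact: measurable_addl.
rewrite -[RHS](ge0_integral_addl c)// -/h'.
rewrite -[LHS]/(\int[mu]_(x in (-%R : _ -> measurableTypeR R) @^-1` setT) (h' \o -%R) x).
rewrite -ge0_integral_pushforward//=; last by move=> y _; exact: h0.
by apply: eq_measure_integral => //= A mA _; exact: lebesgue_measureN.
Qed.

(** With [A] and [B] the integrals along horizontal and vertical lines, [S s] collects the four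
    lines at distance |s| from the point of abscissa [b] and height [a]. Each of the four families
    sweeps the plane once as [s] runs over the reals. *)
Lemma sides_integral (a b : R) (A B : R -> \bar R) :
  measurable_fun setT A -> measurable_fun setT B ->
  (forall x, 0 <= A x) -> (forall x, 0 <= B x) ->
  let S := fun s : R => A (a - s)%R + A (a + s)%R + (B (b + s)%R + B (b - s)%R) in
  [/\ measurable_fun setT S, forall s, 0 <= S s &
    \int[mu]_s S s = \int[mu]_x A x + \int[mu]_x A x + (\int[mu]_x B x + \int[mu]_x B x)].
Proof.
move=> mA mB A0 B0 S.
have mop (c : R) : measurable_fun setT (fun x : R => c - x)%R.
  by apply: measurable_funB; [exact: measurable_cst|exact: measurable_id].
have mA1 : measurable_fun setT (fun s : R => A (a - s)%R) by exact: measurableT_comp.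
have mA2 : measurable_fun setT (fun s : R => A (a + s)%R).
  by apply: measurableT_comp => //; exact: measurable_addl.
have mB1 : measurable_fun setT (fun s : R => B (b + s)%R).
  by apply: measurableT_comp => //; exact: measurable_addl.
have mB2 : measurable_fun setT (fun s : R => B (b - s)%R) by exact: measurableT_comp.
have mAA : measurable_fun setT (fun s : R => A (a - s)%R + A (a + s)%R).
  exact: emeasurable_funD.
have mBB : measurable_fun setT (fun s : R => B (b + s)%R + B (b - s)%R).
  exact: emeasurable_funD.
split; [exact: emeasurable_funD|by move=> s; rewrite !adde_ge0|].
rewrite ge0_integralD//; [|by move=> *; exact: adde_ge0|by move=> *; exact: adde_ge0].
by rewrite !ge0_integralD// !ge0_integral_subl// !ge0_integral_addl.
Qed.

End translation.

Definition square p (r : R) : set (R * R) :=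
  `[p.1 - r, p.1 + r]%classic `*` `[p.2 - r, p.2 + r]%classic.

Lemma measurable_square p r : measurable (square p r).
Proof. by apply: measurableX; exact: measurable_itv. Qed.

Lemma EFin_Rintegral (D : set R) (h : R -> R) : mu.-integrable D (EFin \o h) ->
  measurable D -> ((\int[mu]_(x in D) h x)%:E = \int[mu]_(x in D) (h x)%:E)%E.
Proof. by move=> ih mD; rewrite fineK//; exact: integrable_fin_num. Qed.

(** [mean_value_square] is integrated over s in [r / 2, r], with each side prolonged to a chord of
    the large square. On this range 4 s >= 2 r, and 2 r times the length r / 2 gives r^2; the factor
    4 counts the families of lines in [sides_integral]. *)
Lemma area_mean f p (r : R) : holomorphic_on (@Cplus R) f -> 0 < r < p.2 ->
  ((r ^+ 2 * cnorm (f p))%:E <= 4%:E * \int[mu2]_(z in square p r) (cnorm (f z))%:E)%E.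
Proof.
move=> hf /andP[r0 rp]; have cf := holomorphic_continuous_above hf.
have sqC : square p r `<=` @Cplus R.
  by move=> z [_ /=]; rewrite in_itv/= /Cplus /=; lra.
pose G := (fun z => (cnorm (f z))%:E : \bar R) \_ (square p r).
have mG : measurable_fun setT G.
  apply/measurable_restrict => //; first exact: measurable_square.
  rewrite setTI; apply/measurable_EFinP.
  by apply: measurable_funS (holomorphic_measurable_cnorm hf) => //; exact: measurable_Cplus.
have G0 z : (0 <= G z)%E.
  by rewrite /G /patch; case: ifPn => // _; rewrite lee_fin cnorm_ge0.
have GE x y : p.1 - r <= x <= p.1 + r -> p.2 - r <= y <= p.2 + r ->
    G (x, y) = (cnorm (f (x, y)))%:E.
  by move=> hx hy; rewrite /G patchE mem_set//; split; rewrite /= in_itv.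
pose A y : \bar R := (\int[mu]_x G (x, y))%E.
pose B x : \bar R := (\int[mu]_y G (x, y))%E.
have A0 y : (0 <= A y)%E by exact: integral_ge0.
have B0 x : (0 <= B x)%E by exact: integral_ge0.
have mA : measurable_fun setT A by exact: measurable_fun_fubini_tonelli_G.
have mB : measurable_fun setT B by exact: measurable_fun_fubini_tonelli_F.
have mGx x : measurable_fun setT (fun y => G (x, y)) by exact: measurable_fun_pair2.
have mGy y : measurable_fun setT (fun x => G (x, y)) by exact: measurable_fun_pair1.
have iA : (\int[mu]_y A y = \int[mu2]_(z in square p r) (cnorm (f z))%:E)%E.
  rewrite [RHS]integral_mkcond; apply/esym.
  exact: (@fubini_tonelli2 _ _ (measurableTypeR R) (measurableTypeR R) R mu mu G).
have iB : (\int[mu]_y B y = \int[mu2]_(z in square p r) (cnorm (f z))%:E)%E.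
  rewrite [RHS]integral_mkcond; apply/esym.
  exact: (@fubini_tonelli1 _ _ (measurableTypeR R) (measurableTypeR R) R mu mu G).
have step (a b : R) (h k : R -> R) (H K : R -> \bar R) : a <= b ->
    {within `[a, b], continuous h} -> {within `[a, b], continuous k} ->
    (forall t, 0 <= h t) -> (forall t, 0 <= k t) ->
    measurable_fun setT H -> measurable_fun setT K ->
    (forall t, 0 <= H t)%E -> (forall t, 0 <= K t)%E ->
    (forall t, a <= t <= b -> H t = (h t)%:E /\ K t = (k t)%:E) ->
    ((\int[mu]_(t in `[a, b]) (h t + k t))%:E <= \int[mu]_t H t + \int[mu]_t K t)%E.
  move=> ab ch ck h0 k0 mH mK H0 K0 HK.
  have chk : {within `[a, b], continuous (fun t => h t + k t)}.
    by move=> t; apply: cvgD; [exact: ch|exact: ck].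
  rewrite EFin_Rintegral//; last exact: segment_integrable.
  rewrite -ge0_integralD//.
  have mHK : measurable_fun setT (fun t => H t + K t)%E by exact: emeasurable_funD.
  apply: (@le_trans _ _ (\int[mu]_(t in `[a, b]) (H t + K t))%E).
    rewrite le_eqVlt; apply/orP; left; apply/eqP; apply: eq_integral => t.
    by rewrite inE/= in_itv/= => /HK[-> ->].
  by apply: ge0_subset_integral => // t _; rewrite adde_ge0.
have key s : r / 2 <= s <= r ->
    ((2 * r * cnorm (f p))%:E <=
      A (p.2 - s)%R + A (p.2 + s)%R + (B (p.1 + s)%R + B (p.1 - s)%R))%E.
  move=> hs; have s0 : 0 < s by lra.
  have := @mean_value_square _ f p s hf ltac:(lra).
  have : 2 * r * cnorm (f p) <= 4 * s * cnorm (f p).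
    by rewrite ler_wpM2r ?cnorm_ge0//; lra.
  move=> /le_trans /[apply]; rewrite -lee_fin => /le_trans; apply.
  rewrite EFinD; apply: leeD; apply: step => //; try lra.
  - by apply: (within_horizontal (phi := @cnorm R)) => //; [lra|exact: cnorm_lipschitz].
  - by apply: (within_horizontal (phi := @cnorm R)) => //; [lra|exact: cnorm_lipschitz].
  - by move=> t; exact: cnorm_ge0.
  - by move=> t; exact: cnorm_ge0.
  - by move=> t ht; rewrite !GE//; lra.
  - by apply: (within_vertical (phi := @cnorm R)) => //; [lra|exact: cnorm_lipschitz].
  - by apply: (within_vertical (phi := @cnorm R)) => //; [lra|exact: cnorm_lipschitz].
  - by move=> t; exact: cnorm_ge0.
  - by move=> t; exact: cnorm_ge0.
  - by move=> t ht; rewrite !GE//; lra.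
pose S (s : R) : \bar R := (A (p.2 - s)%R + A (p.2 + s)%R + (B (p.1 + s)%R + B (p.1 - s)%R))%E.
have [mS S0 iS'] := sides_integral p.2 p.1 mA mB A0 B0.
have iS : (\int[mu]_s S s = 4%:E * \int[mu2]_(z in square p r) (cnorm (f z))%:E)%E.
  rewrite iS' iA iB; set X := (\int[mu2]_(z in _) _)%E.
  have X0 : (0 <= X)%E by apply: integral_ge0 => z _; rewrite lee_fin cnorm_ge0.
  have -> : (4%:E = 1 + 1 + (1 + 1) :> \bar R)%E by rewrite -!EFinD; congr EFin; ring.
  by rewrite !ge0_muleDl ?adde_ge0// !mul1e.
rewrite -iS.
have -> : ((r ^+ 2 * cnorm (f p))%:E = \int[mu]_(s in `[(r / 2)%R, r]) (2 * r * cnorm (f p))%:E)%E.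
  rewrite integral_cst//= lebesgue_measure_itv/= lte_fin ifT; last by lra.
  by rewrite -EFinB -EFinM; congr EFin; field.
apply: (@le_trans _ _ (\int[mu]_(s in `[(r / 2)%R, r]) S s)%E).
  apply: ge0_le_integral => //.
  - by move=> s _; rewrite lee_fin !mulr_ge0 ?cnorm_ge0// ltW.
  - exact: measurable_funTS.
by apply: ge0_subset_integral => //= s _; exact: S0.
Qed.

End AreaMean.

(** * Growth functions and the Luxemburg norm *)

Section GrowthFunctions.
Variables (R : realType) (Phi : R -> R).
Hypothesis PhiU : class_U Phi.

Lemma class_U_ge0 (s : R) : 0 <= s -> 0 <= Phi s.
Proof.
by have [q [_ [[_ _ surj] _ _]]] := PhiU => s0; have : [set t | 0 <= t] (Phi s)
  by rewrite -surj; exists s.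
Qed.

Lemma class_U_le (s t : R) : 0 <= s -> s <= t -> Phi s <= Phi t.
Proof. by have [q [_ [[_ mono _] _ _]]] := PhiU; exact: mono. Qed.

Lemma class_U_surj (s : R) : 0 <= s -> exists2 t, 0 <= t & Phi t = s.
Proof.
have [q [_ [[_ _ surj] _ _]]] := PhiU => s0.
by have : [set t | 0 <= t] s by []; rewrite -surj => -[t t0 <-]; exists t.
Qed.

Lemma class_U0 : Phi 0 = 0.
Proof.
have [t t0 Pt] := class_U_surj (lexx 0).
by apply/eqP; rewrite eq_le class_U_ge0// -[leRHS]Pt class_U_le.
Qed.

(** A zero at s > 0 would spread to all t >= s by the upper growth bound, and [Phi] would miss the
    value 1. *)
Lemma class_U_gt0 (s : R) : 0 < s -> 0 < Phi s.
Proof.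
move=> s0; rewrite lt0r class_U_ge0 ?ltW// andbT; apply/eqP => Ps.
have [t t0 Pt] := class_U_surj ler01.
have [ts|/ltW st] := leP t s.
  by have := class_U_le t0 ts; rewrite Pt Ps ler10.
have [q [_ [_ [C upper] _]]] := PhiU.
have := upper s (t / s) s0; rewrite ler_pdivlMr// mul1r => /(_ st).
by rewrite mulrCA divff ?gt_eqF// mulr1 Pt Ps mulr0 ler10.
Qed.

Lemma class_U_scale (k s : R) : 0 <= k <= 1 -> 0 <= s -> Phi (k * s) <= k * Phi s.
Proof.
move=> /andP[k0 k1]; rewrite le_eqVlt => /predU1P[<-|s0].
  by rewrite mulr0 class_U0 mulr0.
move: k0; rewrite le_eqVlt => /predU1P[<-|k0]; first by rewrite !mul0r class_U0.
have [q [_ [_ _ ratio]]] := PhiU.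
have ks0 : 0 < k * s by rewrite mulr_gt0.
have := ratio (k * s) s ks0 ltac:(by rewrite ler_piMl// ltW).
rewrite ler_pdivrMr// => /le_trans; apply.
by rewrite le_eqVlt; apply/orP; left; apply/eqP; field; rewrite gt_eqF.
Qed.

Lemma class_U_superscale (k s : R) : 1 <= k -> 0 <= s -> k * Phi s <= Phi (k * s).
Proof.
move=> k1 s0; have k0 : 0 < k by lra.
have := @class_U_scale k^-1 (k * s); rewrite mulKf ?gt_eqF// => H.
rewrite mulrC -ler_pdivlMr// mulrC; apply: H; last by rewrite mulr_ge0// ltW.
by rewrite invr_ge0 (ltW k0) invf_le1.
Qed.

Lemma class_U_lt (s t : R) : 0 <= s -> s < t -> Phi s < Phi t.
Proof.
move=> s0 st; have t0 : 0 < t by lra.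
have := @class_U_scale (s / t) t.
rewrite divfK ?gt_eqF// => /(_ _ (ltW t0)).
rewrite divr_ge0 ?(ltW t0)//= ler_pdivrMr// mul1r (ltW st) => /(_ isT) /le_lt_trans; apply.
by rewrite -ltr_pdivlMr ?class_U_gt0// divff ?gt_eqF ?class_U_gt0// ltr_pdivrMr// mul1r.
Qed.

Lemma class_U_leE (s t : R) : 0 <= s -> 0 <= t -> (Phi s <= Phi t) = (s <= t).
Proof.
move=> s0 t0; apply/idP/idP; last exact: class_U_le.
by apply: contraTT; rewrite -!ltNge; exact: class_U_lt.
Qed.

Lemma growth_invK (t : R) : 0 <= t -> growth_inv Phi (Phi t) = t.
Proof.
move=> t0; rewrite /growth_inv.
rewrite (_ : [set _ | _] = [set u | 0 <= u <= t]); last first.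
  apply/seteqP; split => u /=.
    by move=> [u0]; rewrite class_U_leE// => ->; rewrite u0.
  by move=> /andP[u0 ut]; rewrite class_U_leE.
have ub : ubound [set u | 0 <= u <= t] t by move=> u /= /andP[].
apply/eqP; rewrite eq_le ge_sup//=; last by exists 0; rewrite /= lexx.
by apply: ub_le_sup; [exists t|rewrite /= t0 lexx].
Qed.

Lemma growth_invP (s : R) : 0 <= s -> 0 <= growth_inv Phi s /\ Phi (growth_inv Phi s) = s.
Proof. by move=> /class_U_surj[t t0 <-]; rewrite growth_invK. Qed.

Lemma growth_inv_gt0 (s : R) : 0 < s -> 0 < growth_inv Phi s.
Proof.
move=> s0; have [i0 iE] := growth_invP (ltW s0); rewrite lt0r i0 andbT.
by apply: contraTneq s0 => i00; rewrite -iE i00 class_U0 ltxx.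
Qed.

Lemma growth_inv_le (s t : R) : 0 <= s -> s <= t -> growth_inv Phi s <= growth_inv Phi t.
Proof.
move=> s0 st; have [i0 iE] := growth_invP s0.
have [j0 jE] := growth_invP (le_trans s0 st).
by rewrite -class_U_leE// iE jE.
Qed.

(** [Phi] is controlled on [0, oo) only, so the superlevel sets of the composite are computed
    directly: strict monotonicity turns x < Phi(phi) into Phi^-1(x) < phi when x >= 0. *)
Lemma class_U_measurable d (T : measurableType d) (D : set T) (phi : T -> R) :
  (forall x, 0 <= phi x) -> measurable_fun D phi -> measurable_fun D (Phi \o phi).
Proof.
move=> phi0 mphi mD; apply: (measurability _ (RGenOInfty.measurableE R)) => //.
move=> /= _ [_ [x ->] <-]; have [x0|x0] := ltP x 0.
  rewrite (_ : _ @^-1` _ = setT) ?setIT//.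
  apply/seteqP; split => // z _ /=.
  by rewrite in_itv/= andbT (lt_le_trans x0)// class_U_ge0.
have [i0 iE] := growth_invP x0.
rewrite (_ : _ @^-1` _ = phi @^-1` `]growth_inv Phi x, +oo[); last first.
  have ltE z : (x < Phi (phi z)) = (growth_inv Phi x < phi z).
    by rewrite -{1}iE !ltNge class_U_leE.
  by apply/seteqP; split => z /=; rewrite !in_itv/= !andbT ltE.
by apply: mphi => //; exact: measurable_itv.
Qed.

End GrowthFunctions.

Section LuxemburgNorm.
Variables (R : realType) (Phi : R -> R) (alpha : R).
Hypothesis PhiU : class_U Phi.
Implicit Types (f : R * R -> R * R) (p z : R * R).
Notation mu2 := ((@lebesgue_measure R \x @lebesgue_measure R)%E).

Definition orlicz_density f (eta : R) z := Phi (cnorm (f z) / eta) * z.2 `^ alpha.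

Lemma orlicz_density_ge0 f eta z : 0 < eta -> 0 <= orlicz_density f eta z.
Proof.
move=> eta0; rewrite mulr_ge0 ?powR_ge0// class_U_ge0// divr_ge0 ?cnorm_ge0//.
exact: ltW.
Qed.

Lemma measurable_growth_cnorm f eta : holomorphic_on (@Cplus R) f -> 0 < eta ->
  measurable_fun (@Cplus R) (fun z => Phi (cnorm (f z) / eta)).
Proof.
move=> hf eta0; apply: (class_U_measurable PhiU (phi := fun z => cnorm (f z) / eta)).
  by move=> z; rewrite divr_ge0 ?cnorm_ge0// ltW.
apply: measurable_funM; first exact: holomorphic_measurable_cnorm.
exact: measurable_cst.
Qed.

Lemma measurable_weight (D : set (R * R)) : measurable_fun D (fun z : R * R => z.2 `^ alpha).
Proof.
apply: measurable_funTS; apply: (measurableT_comp (measurable_powR alpha)).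
exact: measurable_snd.
Qed.

Lemma measurable_orlicz_density f eta : holomorphic_on (@Cplus R) f -> 0 < eta ->
  measurable_fun (@Cplus R) (orlicz_density f eta).
Proof.
move=> hf eta0; apply: measurable_funM; first exact: measurable_growth_cnorm.
exact: measurable_weight.
Qed.

Lemma measurable_EFin_orlicz_density f eta (D : set (R * R)) :
  holomorphic_on (@Cplus R) f -> 0 < eta -> D `<=` @Cplus R ->
  measurable_fun D (fun z => (orlicz_density f eta z)%:E).
Proof.
move=> hf eta0 DC; apply/measurable_EFinP.
by apply: measurable_funS (measurable_orlicz_density hf eta0) => //; exact: measurable_Cplus.
Qed.

Lemma orlicz_integral_scale f eta (k : R) : holomorphic_on (@Cplus R) f -> 0 < eta -> 1 <= k ->
  (orlicz_integral Phi alpha f (k * eta)%R <= k^-1%:E * orlicz_integral Phi alpha f eta)%E.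
Proof.
move=> hf eta0 k1; have k0 : 0 < k by lra.
have keta0 : 0 < k * eta by rewrite mulr_gt0.
have ki : 0 <= k^-1 <= 1 by rewrite invr_ge0 (ltW k0) invf_le1.
rewrite -ge0_integralZl//; [|exact: measurable_Cplus| | |by rewrite lee_fin; case/andP: ki].
- apply: ge0_le_integral => //.
  + exact: measurable_Cplus.
  + by move=> z _; rewrite lee_fin orlicz_density_ge0.
  + exact: measurable_EFin_orlicz_density.
  + apply: measurable_funeM; exact: measurable_EFin_orlicz_density.
  + move=> z _; rewrite -EFinM lee_fin mulrA ler_wpM2r ?powR_ge0//.
    rewrite (_ : cnorm (f z) / (k * eta) = k^-1 * (cnorm (f z) / eta)).
      by apply: class_U_scale => //; rewrite divr_ge0 ?cnorm_ge0// ltW.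
    by field; rewrite !gt_eqF.
- exact: measurable_EFin_orlicz_density.
- by move=> z _; rewrite lee_fin orlicz_density_ge0.
Qed.

Lemma orlicz_integral_ge0 f eta : 0 < eta -> (0 <= orlicz_integral Phi alpha f eta)%E.
Proof. by move=> eta0; apply: integral_ge0 => z _; rewrite lee_fin orlicz_density_ge0. Qed.

Lemma lux_norm_ge0 f : 0 <= lux_norm Phi alpha f.
Proof.
rewrite /lux_norm; set S := (X in inf X).
have [->|/set0P S0] := eqVneq S set0; first by rewrite inf0.
by apply: lb_le_inf => // x [/ltW].
Qed.

Lemma lux_norm_le f (eta : R) : 0 < eta -> (orlicz_integral Phi alpha f eta <= 1)%E ->
  lux_norm Phi alpha f <= eta.
Proof. by move=> eta0 h; apply: ge_inf => //; exists 0 => x [/ltW]. Qed.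

Lemma orlicz_integral_le1 f (eta : R) : bergman_orlicz Phi alpha f ->
  lux_norm Phi alpha f < eta -> (orlicz_integral Phi alpha f eta <= 1)%E.
Proof.
move=> [hf fin] Neta.
have [|l [l0 l1] leta] := @inf_lt _ _ _ _ Neta.
  have := orlicz_integral_ge0 f ltr01; move: fin.
  case E : (orlicz_integral Phi alpha f 1) => [I| |]// _; rewrite lee_fin => I0.
  have I1 : 1 <= 1 + I by rewrite lerDl.
  (* The set defining the norm is nonempty: enlarging the parameter from 1 to 1 + I divides the
     integral I by at least 1 + I. *)
  exists (1 + I); split; first by apply: lt_le_trans I1.
  have := orlicz_integral_scale hf ltr01 I1; rewrite mulr1 E => /le_trans; apply.
  by rewrite -EFinM lee_fin mulrC ler_pdivrMr ?mul1r ?lerDr// (lt_le_trans _ I1).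
have k1 : 1 <= eta / l by rewrite ler_pdivlMr// mul1r ltW.
have := orlicz_integral_scale hf l0 k1; rewrite divfK ?gt_eqF// => /le_trans; apply.
apply: (@le_trans _ _ ((eta / l)^-1%:E * 1)%E).
  by apply: lee_wpmul2l => //; rewrite lee_fin invr_ge0 (le_trans ler01).
by rewrite mule1 lee_fin invf_le1// (lt_le_trans ltr01).
Qed.

(** The constant is 20 = 16 + 4. Values of |f| below [eta * lam] account for at most 16 r^2 lam eta
    in [area_mean] (its factor 4 times the area 4 r^2), and the remaining 4 r^2 lam eta must come
    from the integral of [Phi]. *)
Lemma large_value f eta (r lam : R) p : holomorphic_on (@Cplus R) f -> 0 < eta -> 0 < lam ->
  0 < r < p.2 -> 20 * lam * eta < cnorm (f p) ->
  ((r ^+ 2 * Phi lam)%:E <=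
    \int[mu2]_(z in square p r) (Phi (cnorm (f z) / eta))%:E)%E.
Proof.
move=> hf eta0 lam0 rp large; have r0 : 0 < r by case/andP: rp.
have sqC : square p r `<=` @Cplus R.
  by move=> z [_ /=]; rewrite in_itv/= /Cplus /=; case/andP: rp; lra.
have msq := measurable_square p r.
have Pl := class_U_gt0 PhiU lam0.
have mf : measurable_fun (square p r) (fun z => (cnorm (f z))%:E).
  apply/measurable_EFinP.
  by apply: measurable_funS (holomorphic_measurable_cnorm hf) => //; exact: measurable_Cplus.
have mP : measurable_fun (square p r) (fun z => (Phi (cnorm (f z) / eta))%:E).
  apply/measurable_EFinP.
  by apply: measurable_funS (measurable_growth_cnorm hf eta0) => //; exact: measurable_Cplus.
have P0 z : (0 <= (Phi (cnorm (f z) / eta))%:E)%E.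
  by rewrite lee_fin class_U_ge0// divr_ge0 ?cnorm_ge0// ltW.
set X := (\int[mu2]_(z in square p r) (Phi _)%:E)%E.
have X0 : (0 <= X)%E by exact: integral_ge0.
have k0 : 0 <= eta * lam / Phi lam by rewrite divr_ge0 ?mulr_ge0// ltW.
(* For [t >= lam] one has [t <= lam / Phi lam * Phi t], as [Phi t / t] is nondecreasing. *)
have pw z : cnorm (f z) <= eta * lam + eta * lam / Phi lam * Phi (cnorm (f z) / eta).
  set t := cnorm (f z) / eta; have t0 : 0 <= t by rewrite divr_ge0 ?cnorm_ge0// ltW.
  have -> : cnorm (f z) = eta * t by rewrite /t mulrCA divff ?mulr1// gt_eqF.
  have Pt := class_U_ge0 PhiU t0.
  rewrite -!mulrA -mulrDr ler_wpM2l ?(ltW eta0)//.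
  have [tl|lt] := leP t lam.
    by rewrite (le_trans tl)// lerDl mulr_ge0 ?mulr_ge0 ?invr_ge0// ltW.
  apply: (@le_trans _ _ (lam * ((Phi lam)^-1 * Phi t))); last by rewrite lerDr ltW.
  have k1 : 1 <= t / lam by rewrite ler_pdivlMr// mul1r ltW.
  have := class_U_superscale PhiU k1 (ltW lam0); rewrite divfK ?gt_eqF//.
  rewrite -ler_pdivlMr// ler_pdivrMr// => /le_trans; apply.
  by rewrite le_eqVlt; apply/orP; left; apply/eqP; ring.
have msqE : mu2 (square p r) = (4 * r ^+ 2)%:E.
  rewrite product_measure1E//=.
  rewrite !lebesgue_measure_itv/= !lte_fin !ifT; [|lra|lra].
  by rewrite -!EFinB -EFinM; congr EFin; ring.
have int_le : (\int[mu2]_(z in square p r) (cnorm (f z))%:E <=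
    (eta * lam * (4 * r ^+ 2))%:E + (eta * lam / Phi lam)%:E * X)%E.
  apply: (@le_trans _ _ (\int[mu2]_(z in square p r)
      ((eta * lam)%:E + (eta * lam / Phi lam)%:E * (Phi (cnorm (f z) / eta))%:E))%E).
    apply: ge0_le_integral => //.
    - by move=> z _; rewrite lee_fin cnorm_ge0.
    - by apply: emeasurable_funD => //; exact: measurable_funeM.
    - by move=> z _; rewrite -EFinM -EFinD lee_fin.
  rewrite ge0_integralD//.
  - rewrite integral_cst//= msqE -EFinM ge0_integralZl//.
  - by move=> z _; rewrite lee_fin mulr_ge0// ltW.
  - by move=> z _; rewrite mule_ge0.
  - exact: measurable_funeM.
have four0 : (0 <= 4%:E :> \bar R)%E by rewrite lee_fin.
have := le_trans (area_mean hf rp) (lee_wpmul2l four0 int_le).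
case E : X X0 => [x| |]//= X0; last by rewrite leey.
rewrite -?EFinM -?EFinD -?EFinM !lee_fin => h.
have h1 : r ^+ 2 * (20 * lam * eta) <= r ^+ 2 * cnorm (f p) by rewrite ler_wpM2l ?sqr_ge0// ltW.
have h2 : 4 * (eta * lam) * r ^+ 2 <= 4 * (eta * lam / Phi lam) * x by lra.
have h3 : 4 * (eta * lam / Phi lam) * x = 4 * (eta * lam) * (x / Phi lam) by ring.
by move: h2; rewrite h3 ler_pM2l ?mulr_gt0// ler_pdivlMr.
Qed.

End LuxemburgNorm.

(** * Whitney squares *)

Section Whitney.
Variable R : realType.
Implicit Types (z w : R * R) (j k : int) (c : int * int).
Notation mu2 := ((@lebesgue_measure R \x @lebesgue_measure R)%E).

Definition dyadic j : R := 2 `^ j%:~R.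

Lemma dyadic_gt0 j : 0 < dyadic j.
Proof. by rewrite powR_gt0. Qed.

Lemma dyadicD1 j : dyadic (j + 1) = 2 * dyadic j.
Proof.
rewrite /dyadic intrD powRD; last by rewrite pnatr_eq0 implybT.
by rewrite powRr1// mulrC.
Qed.

Lemma ln2_gt0 : 0 < ln 2 :> R.
Proof. by rewrite ln_gt0// ltr1n. Qed.

Lemma dyadic_le j (y : R) : 0 < y -> (dyadic j <= y) = (j%:~R <= ln y / ln 2).
Proof.
move=> y0; rewrite -ler_ln ?posrE ?dyadic_gt0// ln_powR.
by rewrite ler_pdivlMr// ln2_gt0.
Qed.

Definition dyadic_level (y : R) : int := Num.floor (ln y / ln 2).

Lemma dyadic_levelP (y : R) : 0 < y ->
  dyadic (dyadic_level y) <= y < dyadic (dyadic_level y + 1).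
Proof.
by move=> y0; rewrite ltNge !dyadic_le// -ltNge floor_le_tmp floorD1_gt.
Qed.

Lemma dyadic_level_unique j (y : R) : dyadic j <= y < dyadic (j + 1) -> dyadic_level y = j.
Proof.
move=> /andP[jy]; have y0 : 0 < y by apply: lt_le_trans jy; exact: dyadic_gt0.
by rewrite ltNge dyadic_le// -ltNge => yj; apply: floor_def; rewrite -dyadic_le// jy.
Qed.

(* The cell [(0, 0)] of the pair [(j, k)] is the Whitney square of side [2^j] with left side
   [k 2^j]; the cells [(a, b)] with [a], [b] in {-1, 0, 1} tile a neighbourhood of it. *)
Definition cell j k c : set (R * R) :=
  `[(k + c.2)%:~R * dyadic j, (k + c.2 + 1)%:~R * dyadic j[%classic `*`
  `[dyadic (j + c.1), dyadic (j + c.1 + 1)[%classic.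

Definition offsets : seq (int * int) :=
  [seq (a, b) | a <- [:: -1; 0; 1], b <- [:: -1; 0; 1]].

Lemma measurable_cell j k c : measurable (cell j k c).
Proof. by apply: measurableX; exact: measurable_itv. Qed.

Lemma cell_Cplus j k c : cell j k c `<=` @Cplus R.
Proof.
move=> z [_ /=]; rewrite in_itv/= => /andP[h _]; rewrite /Cplus /=.
by apply: lt_le_trans h; exact: dyadic_gt0.
Qed.

(** Columns have width [dyadic j] on every level, whatever [c.1] is. Hence a point determines [c]
    once [(j, k)] is fixed, and [(j, k)] once [c] is fixed; both disjointness lemmas rest on
    this. *)
Lemma cell_unique j k c z : cell j k c z ->
  j + c.1 = dyadic_level z.2 /\ k + c.2 = Num.floor (z.1 / dyadic j).
Proof.
move=> [/=]; rewrite !in_itv/= => h1 /dyadic_level_unique ->; split=> //.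
apply/esym/floor_def; rewrite ler_pdivlMr ?dyadic_gt0// ltr_pdivrMr ?dyadic_gt0//.
Qed.

Lemma cell_cover z : Cplus z -> exists j k, cell j k (0, 0) z.
Proof.
move=> z0; exists (dyadic_level z.2), (Num.floor (z.1 / dyadic (dyadic_level z.2))).
split; rewrite /= in_itv/= !addr0; last exact: dyadic_levelP.
by rewrite -ler_pdivlMr ?dyadic_gt0// -ltr_pdivrMr ?dyadic_gt0// floor_le_tmp floorD1_gt.
Qed.

Lemma trivIset_neighbours j k : trivIset [set` offsets] (cell j k).
Proof.
move=> [a b] [a' b'] _ _ [z [/cell_unique/=[E1 E2] /cell_unique/=[E3 E4]]].
by congr pair; [apply: (addrI j)|apply: (addrI k)]; rewrite ?E1 ?E2 ?E3 ?E4.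
Qed.

(** With h = [dyadic j], the half-side h / 2 keeps heights in [h / 2, 5 h / 2], covered by the
    levels j - 1, j and j + 1, and abscissae within half a column of the cell. *)
Lemma square_neighbours j k z : cell j k (0, 0) z ->
  square z (dyadic j / 2) `<=` \big[setU/set0]_(c <- offsets) cell j k c.
Proof.
set h := dyadic j; have h0 : 0 < h := dyadic_gt0 j.
move=> [/=]; rewrite !in_itv/= !addr0 dyadicD1 -/h intrD mulrDl mul1r => hz1 hz2.
move=> w [/=]; rewrite !in_itv/= => hw1 hw2.
have jm : dyadic (j - 1) = h / 2 by rewrite /h -{2}(subrK 1 j) dyadicD1; field.
have [a aP wa] : exists2 a, a \in [:: -1; 0; 1] & dyadic (j + a) <= w.2 < dyadic (j + a + 1).
  have [l1|g1] := ltP w.2 h.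
    by exists (-1); rewrite ?inE// subrK jm -/h; lra.
  have [l2|g2] := ltP w.2 (2 * h).
    by exists 0; rewrite ?inE// !addr0 dyadicD1 -/h; lra.
  by exists 1; rewrite ?inE// !dyadicD1 -/h; lra.
have [b bP wb] : exists2 b, b \in [:: -1; 0; 1] &
    (k + b)%:~R * h <= w.1 < (k + b + 1)%:~R * h.
  have [l1|g1] := ltP w.1 (k%:~R * h).
    exists (-1); rewrite ?inE// subrK intrB mulrBl mul1r; lra.
  have [l2|g2] := ltP w.1 (k%:~R * h + h).
    by exists 0; rewrite ?inE// !addr0 intrD mulrDl mul1r g1.
  exists 1; rewrite ?inE// !intrD !mulrDl !mul1r; lra.
rewrite -bigcup_seq; exists (a, b); last by split; rewrite /= in_itv.
by apply/allpairsP; exists (a, b).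
Qed.

Lemma sum_offsets_cst (x : \bar R) : (\sum_(c <- offsets) x = 9%:E * x)%E.
Proof. by rewrite big_const_seq count_predT mule_natl GRing.iter_addr_0. Qed.

Section integrals.
Local Open Scope ereal_scope.
Variable F : R * R -> \bar R.
Hypothesis mF : measurable_fun (@Cplus R) F.
Hypothesis F0 : forall z, Cplus z -> 0 <= F z.

Let mFS D : D `<=` @Cplus R -> measurable_fun D F.
Proof. by move=> DC; apply: measurable_funS mF => //; exact: measurable_Cplus. Qed.

Lemma neighbours_Cplus j k : \big[setU/set0]_(c <- offsets) cell j k c `<=` @Cplus R.
Proof. by rewrite -bigcup_seq => z [c _]; exact: cell_Cplus. Qed.

Lemma integral_square_neighbours j k z : cell j k (0, 0)%R z ->
  \int[mu2]_(w in square z (dyadic j / 2)) F w <=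
  \sum_(c <- offsets) \int[mu2]_(w in cell j k c) F w.
Proof.
move=> zjk; have sub := @neighbours_Cplus j k.
rewrite -ge0_integral_bigsetU//.
- apply: ge0_subset_integral => //.
  + exact: measurable_square.
  + by apply: bigsetU_measurable => c _; exact: measurable_cell.
  + exact: mFS.
  + by move=> w /sub/F0.
  + exact: square_neighbours.
- by move=> c; exact: measurable_cell.
- exact: trivIset_neighbours.
- exact: mFS.
- by move=> w /sub/F0.
Qed.

Lemma integral_cell_le j k c :
  \int[mu2]_(w in cell j k c) F w <= \int[mu2]_(w in @Cplus R) F w.
Proof.
apply: ge0_subset_integral => //; [exact: measurable_cell|exact: measurable_Cplus|].
exact: cell_Cplus.
Qed.

Lemma sum_offsets_le j k :
  \sum_(c <- offsets) \int[mu2]_(w in cell j k c) F w <=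
  9%:E * \int[mu2]_(w in @Cplus R) F w.
Proof.
by rewrite -sum_offsets_cst; apply: lee_sum => c _; exact: integral_cell_le.
Qed.

(** Pairs [(j, k)] are enumerated by their codes, a number that codes no pair giving the empty set;
    sums over cells become series over [n]. *)
Definition nth_cell c (n : nat) : set (R * R) :=
  if pickle_inv n is Some jk then cell jk.1 jk.2 c else set0.

Lemma measurable_nth_cell c n : measurable (nth_cell c n).
Proof. by rewrite /nth_cell; case: pickle_inv => // jk; exact: measurable_cell. Qed.

Lemma trivIset_nth_cell c : trivIset setT (nth_cell c).
Proof.
move=> m n _ _; rewrite /nth_cell => -[z []].
have := @pickle_invK (int * int)%type m; have := @pickle_invK (int * int)%type n.
case: pickle_inv => [[j k]|]//= <-; case: pickle_inv => [[j' k']|]//= <-.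
move=> /cell_unique[/= E1 E2] /cell_unique[/= E3 E4].
have jj : j = j' by apply: (addIr c.1); rewrite E1 E3.
by rewrite jj in E4 *; congr (pickle (_, _)); apply: (addIr c.2); rewrite E2 E4 ?jj.
Qed.

Lemma sum_nth_cell c :
  \sum_(n <oo) \int[mu2]_(w in nth_cell c n) F w <= \int[mu2]_(w in @Cplus R) F w.
Proof.
have sub : \bigcup_n nth_cell c n `<=` @Cplus R.
  by move=> z [n _]; rewrite /nth_cell; case: pickle_inv => // jk; exact: cell_Cplus.
rewrite -ge0_integral_bigcup//.
- apply: ge0_subset_integral => //; last exact: measurable_Cplus.
  by apply: bigcupT_measurable => n; exact: measurable_nth_cell.
- by move=> n; exact: measurable_nth_cell.
- exact: mFS.
- by move=> z /sub/F0.
- exact: trivIset_nth_cell.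
Qed.

(** After the sums over offsets and over cells are exchanged, the cells of one offset are disjoint
    and contribute at most one full integral, whence the 9. Cells that miss [E] need no bound, as
    only their traces on [E] are counted. *)
Lemma whitney_sum (m : {measure set (R * R)%type -> \bar R}) (E : set (R * R)) (K : R) :
  measurable E -> E `<=` @Cplus R -> (0 <= K)%R ->
  (forall j k z, E z -> cell j k (0, 0)%R z ->
    m (cell j k (0, 0)%R) <= K%:E * \sum_(c <- offsets) \int[mu2]_(w in cell j k c) F w) ->
  m E <= K%:E * (9%:E * \int[mu2]_(w in @Cplus R) F w).
Proof.
move=> mE EC K0 mK.
have I0 c n : 0 <= \int[mu2]_(w in nth_cell c n) F w.
  apply: integral_ge0 => w; rewrite /nth_cell; case: pickle_inv => // jk.
  by move=> /cell_Cplus/F0.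
have cov : E `<=` \bigcup_n (E `&` nth_cell (0, 0)%R n).
  move=> z Ez; have [j [k zjk]] := cell_cover (EC z Ez).
  exists (pickle (j, k)); first exact: I.
  by split; [exact: Ez|rewrite /nth_cell pickleK_inv].
have mc n : measurable (E `&` nth_cell (0, 0)%R n).
  by apply: measurableI => //; exact: measurable_nth_cell.
apply: (le_trans (measure_sigma_subadditive m mc mE cov)).
apply: (@le_trans _ _ (\sum_(n <oo)
    (K%:E * \sum_(c <- offsets) \int[mu2]_(w in nth_cell c n) F w))).
  apply: lee_nneseries => [n _ _|n _]; first exact: measure_ge0.
  have K0' : 0 <= K%:E * \sum_(c <- offsets) \int[mu2]_(w in nth_cell c n) F w.
    by rewrite mule_ge0// sume_ge0.
  have [->|/set0P[z [Ez zn]]] := eqVneq (E `&` nth_cell (0, 0)%R n) set0.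
    by rewrite measure0.
  apply: (@le_trans _ _ (m (nth_cell (0, 0)%R n))).
    by apply: le_measure; rewrite ?inE; [exact: mc|exact: measurable_nth_cell|move=> ? []].
  by move: zn K0'; rewrite /nth_cell; case: pickle_inv => // -[j k] zjk _; exact: mK zjk.
rewrite nneseriesZl; last by move=> n _; exact: sume_ge0.
apply: lee_wpmul2l; first by rewrite lee_fin.
rewrite nneseries_sum//.
by rewrite -sum_offsets_cst; apply: lee_sum => c _; exact: sum_nth_cell.
Qed.

End integrals.
End Whitney.

(** * From the Carleson condition to the weak type estimate *)

Section WeakType.
Variable R : realType.
Implicit Types (f : R * R -> R * R) (Phi : R -> R) (z p : R * R).
Notation mu2 := ((@lebesgue_measure R \x @lebesgue_measure R)%E).

(** The range is that of the heights in a square of half-side h / 2 centred at a height in [h, 2 h).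
    The minimum of two powers serves both signs of [alpha]. *)
Lemma powR_comparable (alpha : R) : exists2 c : R, 0 < c & forall h y : R, 0 < h ->
  h / 2 <= y <= 5 / 2 * h -> c * h `^ alpha <= y `^ alpha.
Proof.
have h2 : 0 < 1 / 2 :> R by rewrite divr_gt0.
have h52 : 0 < 5 / 2 :> R by rewrite divr_gt0.
exists (Num.min ((1 / 2) `^ alpha) ((5 / 2) `^ alpha)); first by rewrite lt_min !powR_gt0.
move=> h y h0 /andP[hy yh]; set t := y / h.
have yE : y = t * h by rewrite divfK// gt_eqF.
have t2 : 1 / 2 <= t by rewrite ler_pdivlMr//; lra.
have t52 : t <= 5 / 2 by rewrite ler_pdivrMr.
have t0 : 0 < t by lra.
rewrite yE [leRHS]powRM ?(ltW t0) ?(ltW h0)// ler_wpM2r ?powR_ge0// ge_min; apply/orP.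
have [a0|a0] := leP 0 alpha; [left|right].
  by apply: ge0_ler_powR; rewrite ?nnegrE// ltW.
rewrite -[alpha]opprK !(powRN _ (- alpha)) lef_pV2 ?posrE ?powR_gt0//.
by apply: ge0_ler_powR; rewrite ?nnegrE ?oppr_ge0// ltW.
Qed.

Lemma weighted_large_value Phi (alpha : R) : class_U Phi -> exists2 c : R, 0 < c &
  forall f (eta lam h : R) p, holomorphic_on (@Cplus R) f -> 0 < eta -> 0 < lam ->
    0 < h -> h <= p.2 < 2 * h -> 20 * lam * eta < cnorm (f p) ->
    ((c * h `^ (2 + alpha) * Phi lam)%:E <=
      \int[mu2]_(z in square p (h / 2)) (orlicz_density Phi alpha f eta z)%:E)%E.
Proof.
move=> PhiU; have [c c0 cP] := powR_comparable alpha.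
(* The 4 comes from the squared half-side (h / 2)^2. *)
exists (c / 4); first by rewrite divr_gt0.
move=> f eta lam h p hf eta0 lam0 h0 hp large.
have rp : 0 < h / 2 < p.2 by lra.
have sqC : square p (h / 2) `<=` @Cplus R.
  by move=> z [_ /=]; rewrite in_itv/= /Cplus /=; lra.
have k0 : 0 < c * h `^ alpha by rewrite mulr_gt0 ?powR_gt0.
have mP : measurable_fun (square p (h / 2)) (fun z => (Phi (cnorm (f z) / eta))%:E).
  apply/measurable_EFinP.
  by apply: measurable_funS (measurable_growth_cnorm PhiU hf eta0) => //; exact: measurable_Cplus.
have P0 z : (0 <= (Phi (cnorm (f z) / eta))%:E)%E.
  by rewrite lee_fin class_U_ge0// divr_ge0 ?cnorm_ge0// ltW.
have H := large_value PhiU hf eta0 lam0 rp large.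
apply: (@le_trans _ _ ((c * h `^ alpha)%:E *
    \int[mu2]_(z in square p (h / 2)) (Phi (cnorm (f z) / eta))%:E)%E).
  apply: le_trans (lee_wpmul2l _ H); last by rewrite lee_fin ltW.
  rewrite -EFinM lee_fin powRD; last by rewrite (gt_eqF h0) implybT.
  rewrite (_ : h `^ 2 = h ^+ 2); last by rewrite -powR_mulrn// ltW.
  by rewrite le_eqVlt; apply/orP; left; apply/eqP; field.
rewrite -ge0_integralZl//; [|exact: measurable_square|by rewrite lee_fin ltW].
apply: ge0_le_integral => //.
- exact: measurable_square.
- by move=> z _; rewrite mule_ge0// lee_fin ltW.
- exact: measurable_funeM.
- exact: measurable_EFin_orlicz_density.
- move=> z [_ /=]; rewrite in_itv/= => hz.
  rewrite -EFinM lee_fin /orlicz_density mulrC ler_wpM2l//; last by apply: cP => //; lra.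
  by have := P0 z; rewrite lee_fin.
Qed.

(** If the norm were 0, the integral would be at most 1 for every [eta]. Taking [lam] with c h^(2 +
    alpha) Phi(lam) = 2 at the height h of [z], and then [eta] with 20 lam eta = |f z| / 2, makes it
    at least 2. *)
Lemma lux_norm_gt0 Phi (alpha : R) f z : class_U Phi -> bergman_orlicz Phi alpha f ->
  Cplus z -> f z != (0, 0) -> 0 < lux_norm Phi alpha f.
Proof.
move=> PhiU Bf z0 fz0; rewrite lt0r lux_norm_ge0 andbT; apply/eqP => N0.
have [hf _] := Bf; have fz : 0 < cnorm (f z) by rewrite cnorm_gt0.
have [c c0 cP] := weighted_large_value alpha PhiU.
have k0 : 0 < c * z.2 `^ (2 + alpha) by rewrite mulr_gt0 ?powR_gt0.
have l0 : 0 < 2 / (c * z.2 `^ (2 + alpha)) by rewrite divr_gt0.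
have lam0 := growth_inv_gt0 PhiU l0; have [_ lamE] := growth_invP PhiU (ltW l0).
set lam := growth_inv Phi _ in lam0 lamE.
pose eta := cnorm (f z) / (40 * lam); have eta0 : 0 < eta by rewrite divr_gt0 ?mulr_gt0.
have := @cP f eta lam z.2 z hf eta0 lam0 z0.
rewrite lexx /= ltr_pMl// ltr1n => /(_ isT).
have -> : 20 * lam * eta = cnorm (f z) / 2 by rewrite /eta; field; rewrite gt_eqF.
rewrite ltr_pdivrMr// ltr_pMr// ltr1n => /(_ isT); apply/negP; rewrite -ltNge.
apply: (@le_lt_trans _ _ 1%E).
  have := orlicz_integral_le1 PhiU Bf (eta := eta); rewrite N0 => /(_ eta0).
  apply: le_trans; apply: ge0_subset_integral => //.
  - exact: measurable_square.
  - exact: measurable_Cplus.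
  - exact: measurable_EFin_orlicz_density.
  - by move=> w _; rewrite lee_fin orlicz_density_ge0.
  - by move=> w [_ /=]; rewrite in_itv/= /Cplus /=; move: z0; rewrite /Cplus /=; lra.
by rewrite lamE lte_fin mulrCA divff ?gt_eqF// mulr1 ltr1n.
Qed.

Lemma growth_quotient_le (Phi1 Phi2 : R -> R) : class_U Phi1 ->
  (forall s t : R, 0 < s -> s <= t -> Phi2 s / Phi1 s <= Phi2 t / Phi1 t) ->
  forall s t : R, 0 < s -> s <= t ->
    t * Phi2 (growth_inv Phi1 s) <= s * Phi2 (growth_inv Phi1 t).
Proof.
move=> U1 ratio s t s0 st; have t0 : 0 < t by lra.
have := ratio _ _ (growth_inv_gt0 U1 s0) (growth_inv_le U1 (ltW s0) st).
have [_ ->] := growth_invP U1 (ltW s0); have [_ ->] := growth_invP U1 (ltW t0).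
rewrite ler_pdivrMr// mulrAC ler_pdivlMr//; lra.
Qed.

Definition carleson_condition (Phi1 Phi2 : R -> R) (alpha : R)
    (mu : {measure set (R * R)%type -> \bar R}) (C1 : R) :=
  forall (a b : R) (I : set R), a < b -> `]a, b[ `<=` I -> I `<=` `[a, b] ->
    (mu (carleson_box I (b - a))
      <= (C1 / Phi2 (growth_inv Phi1 (1 / (b - a) `^ (2 + alpha))))%:E)%E.

(** The cell reaches up to twice its side, so the box has length [2 * dyadic j], hence the right end
    [k + 2]. *)
Lemma cell_carleson_box j k :
  cell j k (0, 0) `<=` carleson_box `[k%:~R * dyadic R j, (k + 2)%:~R * dyadic R j]
    ((k + 2)%:~R * dyadic R j - k%:~R * dyadic R j).
Proof.
have d0 := dyadic_gt0 R j.
move=> z [/=]; rewrite !in_itv/= !addr0 dyadicD1 !intrD !mulrDl mul1r => h1 h2.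
split; rewrite /= ?in_itv/=; lra.
Qed.

Lemma carleson_weak_type (Phi1 Phi2 : R -> R) (mu : {measure set (R * R)%type -> \bar R})
    (alpha C1 : R) : class_U Phi1 -> class_U Phi2 ->
  (forall s t : R, 0 < s -> s <= t -> Phi2 s / Phi1 s <= Phi2 t / Phi1 t) ->
  0 < C1 -> carleson_condition Phi1 Phi2 alpha mu C1 ->
  exists2 C2 : R, 0 < C2 & forall f (lam : R), bergman_orlicz Phi1 alpha f ->
    (exists z, Cplus z /\ f z <> (0, 0)) -> 0 < lam ->
    ((Phi2 lam)%:E *
      mu [set z | Cplus z /\ (C2 * lam * lux_norm Phi1 alpha f < cnorm (f z))%R] <= 1)%E.
Proof.
move=> U1 U2 ratio C10 carl.
have [c c0 cP] := weighted_large_value alpha U1.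
(* [D] converts the local bound c h^(2 + alpha) into (2 h)^(2 + alpha) / D, the quantity attached to
   a Carleson box of length 2 h. *)
set D := 2 `^ (2 + alpha) / c; have D0 : 0 < D by rewrite divr_gt0 ?powR_gt0.
(* [A] absorbs [C1] through [Phi2], and [B] absorbs the overlap and [D] through [Phi1]; the scaling
   lemmas want factors at least 1. *)
set A := Num.max 1 C1; set B := Num.max 1 (9 * D).
have A1 : 1 <= A by rewrite le_max lexx.
have AC : C1 <= A by rewrite le_max lexx orbT.
have B1 : 1 <= B by rewrite le_max lexx.
have BD : 9 * D <= B by rewrite le_max lexx orbT.
have A0 : 0 < A by lra.
have B0 : 0 < B by lra.
(* The 20 of [large_value] times the 2 of [eta = 2 * N]: [orlicz_integral_le1] applies strictly
   above the norm. *)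
exists (40 * (A * B)); first by rewrite !mulr_gt0.
move=> f lam0 Bf [z0 [z0C fz0]] lam00; have [hf _] := Bf.
have N0 : 0 < lux_norm Phi1 alpha f by apply: (lux_norm_gt0 U1 Bf z0C); exact/eqP.
set N := lux_norm Phi1 alpha f in N0 *; pose eta := 2 * N.
have eta0 : 0 < eta by rewrite mulr_gt0.
have I1 : (orlicz_integral Phi1 alpha f eta <= 1)%E.
  by apply: orlicz_integral_le1 => //; rewrite -/N /eta; lra.
pose lam := A * B * lam0; have lam_gt0 : 0 < lam by rewrite !mulr_gt0.
set E := [set z | _].
have P1l := class_U_gt0 U1 lam_gt0.
pose G s := Phi2 (growth_inv Phi1 s).
have G0 s : 0 < s -> 0 < G s by move=> s0; apply: (class_U_gt0 U2); exact: growth_inv_gt0.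
pose s0 := Phi1 lam / B; have s00 : 0 < s0 by rewrite divr_gt0.
(* [C1] enters the argument of [Phi2] as [A], and A * lam0 = lam / B is at most Phi1^-1(s0) because
   Phi1(lam / B) <= Phi1(lam) / B. *)
have GC : C1 * Phi2 lam0 <= G s0.
  have lB : lam / B = A * lam0 by rewrite /lam; field; rewrite gt_eqF.
  apply: (@le_trans _ _ (Phi2 (A * lam0))).
    apply: le_trans (class_U_superscale U2 A1 (ltW lam00)).
    by rewrite ler_wpM2r// class_U_ge0// ltW.
  have lB0 : 0 <= lam / B by rewrite divr_ge0// ltW.
  apply: (class_U_le U2); first by rewrite -lB.
  rewrite -lB -[leLHS](growth_invK U1)//; apply: (growth_inv_le U1).
    by rewrite class_U_ge0.
  rewrite /s0 mulrC [leRHS]mulrC; apply: (class_U_scale U1); last exact: ltW.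
  by rewrite invr_ge0 (ltW B0) invf_le1.
(* Chosen so that [K * (t * Phi1 lam / D)] equals [C1 * (t * s0 / G s0)], the linear majorant of
   [C1 / G (1 / t)]. *)
pose K := C1 * D / (B * G s0).
have Gs0 := G0 _ s00.
have K0 : 0 <= K by apply: ltW; apply: divr_gt0; exact: mulr_gt0.
have mE : measurable E.
  apply: (@Cplus_superlevel_measurable _ (fun z => cnorm (f z))) => z zC.
  exact/ccontinuous_cnorm/(holomorphic_continuous_above hf).
pose F z := (orlicz_density Phi1 alpha f eta z)%:E.
have mF : measurable_fun (@Cplus R) F by exact: measurable_EFin_orlicz_density.
have F0 z : Cplus z -> (0 <= F z)%E by move=> _; rewrite lee_fin orlicz_density_ge0.
have cellE j k z : E z -> cell j k (0, 0) z ->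
    (mu (cell j k (0%R, 0%R)) <=
     K%:E * \sum_(c <- offsets) \int[mu2]_(w in cell j k c) F w)%E.
  move=> [zC zE] zjk; set h := dyadic R j; have h0 : 0 < h := dyadic_gt0 R j.
  have hz : h <= z.2 < 2 * h.
    by case: zjk => _ /=; rewrite in_itv/= !addr0 dyadicD1.
  have large : 20 * lam * eta < cnorm (f z).
    by apply: le_lt_trans zE; rewrite /lam /eta le_eqVlt; apply/orP; left; apply/eqP; ring.
  have L1 := cP f eta lam h z hf eta0 lam_gt0 h0 hz large.
  have L2 := le_trans L1 (integral_square_neighbours mF F0 zjk).
  have L3 := le_trans L2 (sum_offsets_le mF F0 j k).
  pose t := (2 * h) `^ (2 + alpha); have t0 : 0 < t by rewrite powR_gt0// mulr_gt0.
  have tE : c * h `^ (2 + alpha) * Phi1 lam = t * Phi1 lam / D.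
    by rewrite /t /D powRM ?(ltW h0)//; field; rewrite !gt_eqF// powR_gt0.
  (* A single cell limits its own size: each of its nine neighbours carries at most the whole
     integral, which is at most 1. *)
  have tB : s0 <= 1 / t.
    have : ((t * Phi1 lam / D)%:E <= 9%:E)%E.
      rewrite -tE; apply: (le_trans L3); rewrite -[leRHS]mule1.
      by apply: lee_wpmul2l => //; rewrite lee_fin.
    rewrite lee_fin ler_pdivrMr// => tD.
    by rewrite /s0 ler_pdivrMr// mul1r mulrC ler_pdivlMr// mulrC; lra.
  have len : (k + 2)%:~R * h - k%:~R * h = 2 * h by rewrite intrD; ring.
  have box := carl (k%:~R * h) ((k + 2)%:~R * h) `[k%:~R * h, (k + 2)%:~R * h]%classic.
  apply: (@le_trans _ _ (mu (carleson_box `[k%:~R * h, (k + 2)%:~R * h]%classic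
      ((k + 2)%:~R * h - k%:~R * h)))).
    apply: le_measure; rewrite ?inE; [exact: measurable_cell| |exact: cell_carleson_box].
    rewrite (_ : carleson_box _ _ = `[k%:~R * h, (k + 2)%:~R * h]%classic `*`
        `]0, (k + 2)%:~R * h - k%:~R * h[%classic).
      by apply: measurableX; exact: measurable_itv.
    by apply/seteqP; split => w [] /=; rewrite ?in_itv /carleson_box /= ?in_itv.
  apply: (le_trans (box _ _ _)).
  - by rewrite -subr_gt0 len mulr_gt0.
  - by move=> x /=; rewrite !in_itv/= => /andP[/ltW -> /ltW ->].
  - by [].
  rewrite len -/t -/(G _).
  apply: (@le_trans _ _ (K%:E * (t * Phi1 lam / D)%:E)%E); last first.
    by apply: lee_wpmul2l; [rewrite lee_fin|rewrite -tE].
  rewrite -EFinM lee_fin.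
  have it0 : 0 < 1 / t by rewrite divr_gt0.
  have Gt := G0 _ it0.
  have Q := growth_quotient_le U1 ratio s00 tB.
  rewrite -/(G s0) -/(G (1 / t)) in Q.
  have -> : K * (t * Phi1 lam / D) = C1 * (t * s0 / G s0).
    by rewrite /K /s0; field; rewrite !gt_eqF.
  rewrite ler_wpM2l ?(ltW C10)//.
  rewrite ler_pdivlMr// mulrC ler_pdivrMr//.
  have -> : G s0 = t * (1 / t * G s0) by field; rewrite gt_eqF.
  by rewrite -[leRHS]mulrA ler_wpM2l// ltW.
have := whitney_sum mF F0 mE (fun z => @proj1 _ _) K0 cellE.
move=> muE; apply: (@le_trans _ _ ((Phi2 lam0)%:E * (K%:E * (9%:E * 1)))%E).
  apply: lee_wpmul2l; first by rewrite lee_fin class_U_ge0// ltW.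
  apply: (le_trans muE); apply: lee_wpmul2l; first by rewrite lee_fin.
  by apply: lee_wpmul2l => //; rewrite lee_fin.
rewrite mule1 -!EFinM lee_fin /K.
have -> : Phi2 lam0 * (C1 * D / (B * G s0) * 9) = (C1 * Phi2 lam0 * (9 * D)) / (G s0 * B).
  by field; rewrite !gt_eqF.
rewrite ler_pdivrMr ?mulr_gt0// mul1r; apply: ler_pM => //.
  by rewrite mulr_ge0 ?(ltW C10)// class_U_ge0// ltW.
by rewrite mulr_ge0// ltW.
Qed.

End WeakType.

(** * Integrals of powers of the Cauchy kernel *)

Section KernelIntegral.
Variable R : realType.
Implicit Types (z p : R * R).
Notation mu := (@lebesgue_measure R).
Notation mu2 := ((@lebesgue_measure R \x @lebesgue_measure R)%E).

Lemma integral_powR (b x y : R) : 0 < x -> x < y -> b + 1 != 0 ->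
  (\int[mu]_(t in `[x, y]) (t `^ b)%:E = ((y `^ (b + 1) - x `^ (b + 1)) / (b + 1))%:E)%E.
Proof.
move=> x0 xy b0; pose F t := (b + 1)^-1 * t `^ (b + 1).
have dF (t : R) : 0 < t -> is_derive t 1 F (t `^ b).
  move=> t0; have -> : t `^ b = (b + 1)^-1 * ((b + 1) * t `^ (b + 1 - 1)).
    by rewrite mulKf// addrK.
  exact: is_deriveZ (is_derive1_powR (b + 1) t0).
have cF (t : R) : 0 < t -> {for t, continuous F}.
  by move=> t0; apply/differentiable_continuous/derivable1_diffP; have [] := dF t t0.
have cpow (t : R) : 0 < t -> {for t, continuous (fun u => u `^ b)}.
  move=> t0; apply/differentiable_continuous/derivable1_diffP.
  by have [] := is_derive1_powR b t0.
rewrite (@continuous_FTC2 _ _ F)//.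
- by rewrite -EFinB /F; congr EFin; rewrite mulrBl ![_ / _]mulrC.
- apply: continuous_in_subspaceT => t; rewrite inE/= in_itv/= => /andP[xt _].
  by apply: cpow; lra.
- split.
  + by move=> t; rewrite in_itv/= => /andP[xt _]; have [] := dF t ltac:(lra).
  + by apply: cvg_at_right_filter; exact: cF.
  + by apply: cvg_at_left_filter; apply: cF; lra.
- move=> t; rewrite in_itv/= => /andP[xt _].
  by rewrite derive1E; have [_ ->] := dF t ltac:(lra).
Qed.

(** The identity 1 / x = x * (x^2)^(-1), valid also at 0, reduces the inverse to a real power of a
    nonnegative function. *)
Lemma measurable_funV d (T : measurableType d) (D : set T) (f : T -> R) :
  measurable_fun D f -> measurable_fun D (fun x => (f x)^-1).
Proof.
move=> mf; rewrite (_ : (fun x => _) = (fun x => f x * (f x ^+ 2) `^ (-1))); last first.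
  apply/funext => x; rewrite powR_inv1 ?sqr_ge0//.
  have [->|fx] := eqVneq (f x) 0; first by rewrite mul0r invr0.
  by field.
apply: measurable_funM => //; apply: (measurableT_comp (measurable_powR (-1))).
exact: measurable_funX.
Qed.

Lemma measurable_weight_decay (alpha L : R) (M : nat) (D : set R) :
  measurable_fun D (fun y : R => (y `^ alpha * ((1 + y / L) ^+ M)^-1)%:E).
Proof.
apply: measurable_funTS; apply/measurable_EFinP; apply: measurable_funM.
  exact: measurable_powR.
apply: measurable_funV.
apply: measurable_funX; apply: measurable_funD; first exact: measurable_cst.
by apply: measurable_funM; [exact: measurable_id|exact: measurable_cst].
Qed.

(** Below [L] the decay factor is at most 1 and y^alpha is integrable at 0; above [L] it is at most
    (y / L)^(-M), integrable at infinity against y^alpha. The two ranges give the two summands of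
    the constant. *)
Lemma integral_weight_decay (alpha L : R) (M : nat) : -1 < alpha -> 1 + alpha < M%:R -> 0 < L ->
  (\int[mu]_(y in `]0%R, +oo[) (y `^ alpha * ((1 + y / L) ^+ M)^-1)%:E <=
    (((1 + alpha)^-1 + (M%:R - (1 + alpha))^-1) * L `^ (1 + alpha))%:E)%E.
Proof.
move=> a1 aM L0; pose w (y : R) : \bar R := (y `^ alpha * ((1 + y / L) ^+ M)^-1)%:E.
rewrite -[X in (X <= _)%E]/(\int[mu]_(y in `]0%R, +oo[) w y)%E.
have a10 : 0 < 1 + alpha by lra.
have Ma0 : 0 < M%:R - (1 + alpha) by lra.
have w0 (y : R) : 0 <= y -> (0 <= w y)%E.
  move=> y0; rewrite lee_fin mulr_ge0 ?powR_ge0// invr_ge0 exprn_ge0//.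
  by rewrite addr_ge0// divr_ge0// ltW.
(* Compact intervals exhausting the half-line; the shift by 2 keeps [L] strictly inside each of
   them. *)
pose S (n : nat) : set R := `[L / n.+2%:R, L * n.+2%:R]%classic.
have n1 (n : nat) : 1 < n.+2%:R :> R by rewrite ltr1n.
have nS (n : nat) : L / n.+2%:R < L /\ L < L * n.+2%:R.
  by split; [rewrite ltr_pdivrMr ?ltr0n// ltr_pMr// n1|rewrite ltr_pMr// n1].
have Sn0 (n : nat) : 0 < L / n.+2%:R by rewrite divr_gt0.
have SE : \bigcup_n S n = `]0, +oo[%classic.
  apply/seteqP; split => [y [n _]|y]; rewrite /= !in_itv/= ?andbT.
    by move=> /andP[ly _]; exact: lt_le_trans (Sn0 n) ly.
  move=> y0; exists (Num.truncn (Num.max (L / y) (y / L))) => //.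
  set n := Num.truncn _; have : Num.max (L / y) (y / L) < n.+1%:R by exact: truncnS_gt.
  rewrite gt_max => /andP[h1 h2].
  have nn : n.+1%:R <= n.+2%:R :> R by rewrite ler_nat.
  rewrite /S /= in_itv/= ler_pdivrMr ?ltr0n// mulrC -ler_pdivrMr//.
  rewrite (le_trans (ltW h1) nn)/= mulrC -ler_pdivrMr//.
  exact: le_trans (ltW h2) nn.
have mw D : measurable_fun D w by exact: measurable_weight_decay.
have ndS : nondecreasing_seq S.
  move=> m n mn; apply/subsetPset => y; rewrite /S /= !in_itv/= => /andP[h1 h2].
  have le2 : m.+2%:R <= n.+2%:R :> R by rewrite ler_nat.
  apply/andP; split; [apply: le_trans h1|apply: (le_trans h2)].
    by rewrite ler_pM2l// lef_pV2 ?posrE ?ltr0n.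
  by rewrite ler_pM2l.
rewrite -SE.
have cvgS := @ge0_nondecreasing_set_cvg_integral _ (measurableTypeR R) R S w mu ndS
  (fun i => measurable_itv _) (fun i => mw _)
  (fun i x => ltac:(by rewrite /S /= in_itv/= => /andP[h _]; apply: w0; exact: le_trans (ltW (Sn0 i)) h)).
rewrite -(cvg_lim _ cvgS)//; apply: lime_le; first by apply/cvg_ex; eexists; exact: cvgS.
apply: nearW => n; have [nL Ln] := nS n.
have Sle : S n `<=` `[L / n.+2%:R, L]%classic `|` `[L, L * n.+2%:R]%classic.
  move=> y; rewrite /S /= !in_itv/= => /andP[-> ->]; rewrite andbT.
  by have [?|/ltW ?] := leP y L; [left|right].
have ypos y : (`[L / n.+2%:R, L]%classic `|` `[L, L * n.+2%:R]%classic) y -> 0 < y.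
  by case; rewrite /= in_itv/= => /andP[h _]; [exact: lt_le_trans (Sn0 n) h|exact: lt_le_trans h].
have split_le : (\int[mu]_(y in S n) w y <= \int[mu]_(y in `[(L / n.+2%:R)%R, L]) w y +
    \int[mu]_(y in `[L, (L * n.+2%:R)%R]) w y)%E.
  have -> : S n = `[L / n.+2%:R, L[%classic `|` `[L, L * n.+2%:R]%classic.
    by rewrite -itv_bndbnd_setU// !bnd_simp ltW.
  rewrite ge0_integral_setU//; first last.
  - apply/disj_setPS => y []; rewrite /= !in_itv/= => /andP[_ yL] /andP[Ly _].
    by move: (lt_le_trans yL Ly); rewrite ltxx.
  - move=> y [|]; rewrite /= in_itv/= => /andP[h _]; apply: w0.
      exact: le_trans (ltW (Sn0 n)) h.
    exact: le_trans (ltW L0) h.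
  - exact: mw.
  - by rewrite integral_itv_bndo_bndc//; exact: mw.
apply: (le_trans split_le); rewrite mulrDl EFinD; apply: leeD.
  apply: (@le_trans _ _ (\int[mu]_(y in `[(L / n.+2%:R)%R, L]) (y `^ alpha)%:E)%E).
    apply: ge0_le_integral => //.
    - by move=> y; rewrite /= in_itv/= => /andP[h _]; apply: w0; exact: le_trans (ltW (Sn0 n)) h.
    - exact: mw.
    - by apply/measurable_EFinP; apply: measurable_funTS; exact: measurable_powR.
    - move=> y; rewrite /= in_itv/= => /andP[h _]; rewrite lee_fin.
      rewrite ler_piMr ?powR_ge0// invf_le1.
        by rewrite exprn_ege1// lerDl divr_ge0// ?(ltW L0)// (le_trans (ltW (Sn0 n)) h).
      by rewrite exprn_gt0// ltr_wpDr// divr_ge0 ?(ltW L0)// (le_trans (ltW (Sn0 n)) h).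
  rewrite integral_powR//; last by rewrite addrC gt_eqF.
  rewrite lee_fin [alpha + 1]addrC mulrC ler_wpM2l ?invr_ge0 ?(ltW a10)//.
  by rewrite gerBl powR_ge0.
apply: (@le_trans _ _ (\int[mu]_(y in `[L, (L * n.+2%:R)%R]) ((L ^+ M)%:E * (y `^ (alpha - M%:R))%:E))%E).
  apply: ge0_le_integral => //.
  - by move=> y; rewrite /= in_itv/= => /andP[h _]; apply: w0; exact: le_trans (ltW L0) h.
  - exact: mw.
  - apply: measurable_funeM; apply/measurable_EFinP; apply: measurable_funTS.
    exact: measurable_powR.
  - move=> y; rewrite /= in_itv/= => /andP[h _]; have y0 : 0 < y := lt_le_trans L0 h.
    rewrite -EFinM lee_fin powRB; last by rewrite (gt_eqF y0) implybT.
    rewrite powR_mulrn ?(ltW y0)// mulrCA ler_wpM2l ?powR_ge0//.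
    have -> : L ^+ M / y ^+ M = ((y / L) ^+ M)^-1 by rewrite expr_div_n invf_div.
    have yL0 : 0 < y / L by rewrite divr_gt0.
    rewrite lef_pV2 ?posrE ?exprn_gt0 ?addr_gt0//.
    by rewrite lerXn2r ?nnegrE ?addr_ge0 ?(ltW yL0)// lerDr.
rewrite ge0_integralZl//.
- rewrite integral_powR//; last by rewrite lt_eqF//; lra.
  rewrite -EFinM lee_fin.
  have -> : L `^ (1 + alpha) = L ^+ M * L `^ (alpha - M%:R + 1).
    rewrite -powR_mulrn ?(ltW L0)// -powRD; last by rewrite (gt_eqF L0) implybT.
    by congr powR; ring.
  rewrite [leRHS]mulrCA ler_wpM2l ?exprn_ge0 ?(ltW L0)//.
  set u := L `^ _; set v := _ `^ _; have v0 : 0 <= v by exact: powR_ge0.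
  have -> : (v - u) / (alpha - M%:R + 1) = (M%:R - (1 + alpha))^-1 * (u - v).
    by field; rewrite gt_eqF//= lt_eqF//; lra.
  by rewrite ler_wpM2l ?invr_ge0 ?(ltW Ma0)// gerBl.
- by apply/measurable_EFinP; apply: measurable_funTS; exact: measurable_powR.
- by move=> y _; rewrite lee_fin powR_ge0.
- by rewrite lee_fin exprn_ge0// ltW.
Qed.

(** Translation and evenness reduce to twice [integral_weight_decay] with [alpha = 0] and [M = 2],
    whose constant is 1 + 1. *)
Lemma integral_symmetric_decay (c L : R) : 0 < L ->
  (\int[mu]_x (((1 + `|x - c| / L) ^+ 2)^-1)%:E <= (4 * L)%:E)%E.
Proof.
move=> L0; pose g (x : R) := ((1 + `|x| / L) ^+ 2)^-1.
have gp (x : R) : 0 < 1 + `|x| / L by rewrite ltr_wpDr// divr_ge0// ltW.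
have g0 (x : R) : 0 <= g x by rewrite invr_ge0 sqr_ge0.
have cg : continuous g.
  move=> x; apply: cvgV; first by rewrite expf_neq0// gt_eqF.
  apply: (@cvg_comp _ _ _ (fun t : R => 1 + `|t| / L) (fun t : R => t ^+ 2)); last exact: exprn_continuous.
  by apply: cvgD; [exact: cvg_cst|apply: cvgMl; exact: norm_continuous].
have mg : measurable_fun setT (EFin \o g) by apply/measurable_EFinP; exact: continuous_measurable_fun.
rewrite -(ge0_integral_addl c); first last.
- by move=> x; rewrite lee_fin invr_ge0 sqr_ge0.
- have mc : measurable_fun setT (fun x : R => - c + x) by exact: measurable_addl.
  have := measurableT_comp mg mc; congr measurable_fun.
  by apply/funext => x /=; rewrite addrC.
have -> : (\int[mu]_x (((1 + `|c + x - c| / L) ^+ 2)^-1)%:E = \int[mu]_x (g x)%:E)%E.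
  by apply: eq_integral => x _; rewrite addrAC subrr add0r.
rewrite ge0_symfun_integralT//; last by move=> x; rewrite /g /= normrN.
rewrite -set_itvcy -integral_itv_obnd_cbnd; last by apply: measurable_funTS.
have := @integral_weight_decay 0 L 2 ltac:(lra) ltac:(lra) L0.
rewrite !addr0 powRr1 ?(ltW L0)// => H.
apply: (@le_trans _ _ (2%:E * ((1^-1 + (2 - 1)^-1) * L)%:E)%E).
  apply: lee_wpmul2l; first by rewrite lee_fin.
  apply: le_trans H; rewrite le_eqVlt; apply/orP; left; apply/eqP; apply: eq_integral => x.
  by rewrite inE/= in_itv/= andbT => x0; rewrite powRr0 mul1r /g gtr0_norm.
have -> : (2 : R) - 1 = 1 by ring.
by rewrite -EFinM lee_fin invr1 le_eqVlt; apply/orP; left; apply/eqP; ring.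
Qed.

(** Each bound sees one variable only, so that spending some powers of the kernel on each separates
    the double integral. The second is (L + |x - c|)^2 <= 2 (L^2 + |x - c|^2). *)
Lemma cnorm_kernel_ge (c L : R) z : 0 < L -> Cplus z ->
  (1 + z.2 / L) * L <= cnorm (csub z (c, - L)) /\
  (1 + `|z.1 - c| / L) ^+ 2 * L ^+ 2 <= 2 * cnorm (csub z (c, - L)) ^+ 2.
Proof.
rewrite /Cplus /= => L0 z0; rewrite sqr_cnorm /= opprK; split.
  apply: le_trans (normr_snd_le _); rewrite /= opprK.
  rewrite mulrDl mul1r divfK ?gt_eqF// addrC; exact: ler_norm.
rewrite -exprMn mulrDl mul1r divfK ?gt_eqF//.
rewrite -[(z.1 - c) ^+ 2]real_normK ?num_real//.
have := sqr_ge0 (L - `|z.1 - c|); have := mulr_gt0 z0 L0; have := sqr_ge0 z.2; lra.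
Qed.

Lemma kernel_integral (alpha : R) : -1 < alpha ->
  exists (M : nat), exists2 C : R, 0 < C & forall c L : R, 0 < L ->
    (\int[mu2]_(z in @Cplus R) ((L / cnorm (csub z (c, - L))) ^+ M * z.2 `^ alpha)%:E <=
      (C * L `^ (2 + alpha))%:E)%E.
Proof.
(* More than 1 + alpha powers make the integral in y converge, and the two extra ones in [M.+2]
   serve the integral in x. The 8 is the 2 of [cnorm_kernel_ge] times the 4 of
   [integral_symmetric_decay]. *)
move=> a1; pose M := (Num.truncn (1 + alpha)).+1.
have aM : 1 + alpha < M%:R by exact: truncnS_gt.
set C0 := (1 + alpha)^-1 + (M%:R - (1 + alpha))^-1.
have C00 : 0 < C0 by rewrite addr_gt0// invr_gt0; lra.
exists M.+2, (8 * C0); first by rewrite mulr_gt0.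
move=> c L L0.
pose g (x : R) := (2 * ((1 + `|x - c| / L) ^+ 2)^-1)%:E : \bar R.
pose w (y : R) := (y `^ alpha * ((1 + y / L) ^+ M)^-1)%:E : \bar R.
pose h := w \_ (`]0%R, +oo[%classic : set R).
have mnorm : measurable_fun setT (fun x : R => `|x - c|).
  apply: measurableT_comp => //; apply: measurable_funB; first exact: measurable_id.
  exact: measurable_cst.
have mg1 : measurable_fun setT (fun x : R => ((1 + `|x - c| / L) ^+ 2)^-1).
  apply: measurable_funV.
  apply: measurable_funX; apply: measurable_funD; first exact: measurable_cst.
  by apply: measurable_funM => //; exact: measurable_cst.
have mg : measurable_fun setT g.
  by apply/measurable_EFinP; apply: measurable_funM => //; exact: measurable_cst.
have mh : measurable_fun setT h.
  apply/measurable_restrict => //.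
  exact: measurable_weight_decay.
have g0 x : (0 <= g x)%E by rewrite lee_fin mulr_ge0// invr_ge0 sqr_ge0.
have h0 y : (0 <= h y)%E.
  rewrite /h patchE; case: ifPn => //; rewrite inE/= in_itv/= andbT => y0.
  by rewrite lee_fin mulr_ge0 ?powR_ge0// invr_ge0 exprn_ge0// addr_ge0// divr_ge0// ltW.
pose G (z : R * R) := (g z.1 * h z.2)%E.
have mG : measurable_fun setT G.
  by apply: emeasurable_funM; [exact: (measurableT_comp mg measurable_fst)
    |exact: (measurableT_comp mh measurable_snd)].
have G0 z : (0 <= G z)%E by exact: mule_ge0.
have mk : measurable_fun (@Cplus R) (fun z : R * R =>
    ((L / cnorm (csub z (c, - L))) ^+ M.+2 * z.2 `^ alpha)%:E).
  apply/measurable_EFinP; apply: measurable_funM; last exact: measurable_weight.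
  apply: measurable_funX; apply: measurable_funM; first exact: measurable_cst.
  apply: measurable_funV.
  apply: ccontinuous_measurable_fun => z _ e e0; exists e => // z' zz'.
  apply: (le_trans (cnorm_lipschitz _ _)); apply: ltW.
  rewrite (_ : csub _ _ = csub z' z)//; by congr pair => /=; ring.
apply: (@le_trans _ _ (\int[mu2]_z G z)%E).
  apply: (@le_trans _ _ (\int[mu2]_(z in @Cplus R) G z)%E); last first.
    by apply: ge0_subset_integral => //; exact: measurable_Cplus.
  apply: ge0_le_integral => //.
  - exact: measurable_Cplus.
  - move=> z zC; rewrite lee_fin mulr_ge0 ?powR_ge0// exprn_ge0//.
    by rewrite divr_ge0 ?cnorm_ge0// ltW.
  - exact: measurable_funTS.
  - move=> z zC; have z0 : 0 < z.2 by exact: zC.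
    rewrite /G /h patchE mem_set; last by rewrite /= in_itv/= andbT.
    rewrite -EFinM lee_fin [leRHS]mulrCA mulrC ler_wpM2l ?powR_ge0//.
    have [H1 H2] := @cnorm_kernel_ge c L z L0 zC.
    set rho := cnorm _ in H1 H2 *.
    have y1 : 0 < 1 + z.2 / L by rewrite addr_gt0// divr_gt0.
    have x1 : 0 < 1 + `|z.1 - c| / L by rewrite ltr_wpDr// divr_ge0// ltW.
    have rho0 : 0 < rho by apply: lt_le_trans H1; rewrite mulr_gt0.
    rewrite exprSr exprSr -mulrA -expr2 mulrC.
    apply: ler_pM; rewrite ?exprn_ge0 ?divr_ge0 ?(ltW L0) ?(ltW rho0)//.
      rewrite expr_div_n ler_pdivrMr ?exprn_gt0// mulrAC ler_pdivlMr ?exprn_gt0//.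
      by rewrite mulrC.
    rewrite -exprVn lerXn2r ?nnegrE ?divr_ge0 ?invr_ge0 ?(ltW L0) ?(ltW rho0) ?(ltW y1)//.
    by rewrite ler_pdivrMr// mulrC ler_pdivlMr// mulrC.
have -> : (\int[mu2]_z G z = \int[mu]_x \int[mu]_y G (x, y))%E.
  exact: (@fubini_tonelli1 _ _ (measurableTypeR R) (measurableTypeR R) R mu mu G).
have ih : (\int[mu]_y h y <= (C0 * L `^ (1 + alpha))%:E)%E.
  by rewrite -integral_mkcond; exact: integral_weight_decay.
have ih0 : (0 <= \int[mu]_y h y)%E by exact: integral_ge0.
have -> : (\int[mu]_x \int[mu]_y G (x, y) = (\int[mu]_x g x) * (\int[mu]_y h y))%E.
  rewrite -ge0_integralZr//; apply: eq_integral => x _; rewrite /G /= ge0_integralZl//.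
have ig : (\int[mu]_x g x <= (8 * L)%:E)%E.
  have -> : (\int[mu]_x g x = 2%:E * \int[mu]_x (((1 + `|x - c| / L) ^+ 2)^-1)%:E)%E.
    rewrite -ge0_integralZl//.
    - by apply/measurable_EFinP.
    - by move=> x _; rewrite lee_fin invr_ge0 sqr_ge0.
  apply: (@le_trans _ _ (2%:E * (4 * L)%:E)%E).
    by apply: lee_wpmul2l; [rewrite lee_fin|exact: integral_symmetric_decay].
  by rewrite -EFinM lee_fin mulrA -natrM.
apply: (@le_trans _ _ ((8 * L)%:E * (C0 * L `^ (1 + alpha))%:E)%E).
  by apply: lee_pmul => //; exact: integral_ge0.
rewrite -EFinM lee_fin (_ : 2 + alpha = 1 + (1 + alpha)); last by ring.
rewrite [L `^ (1 + (1 + alpha))]powRD; last by rewrite (gt_eqF L0) implybT.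
by rewrite powRr1 ?(ltW L0)// le_eqVlt; apply/orP; left; apply/eqP; ring.
Qed.

End KernelIntegral.

(** * From the weak type estimate to the Carleson condition *)

Section TestFunctions.
Variable R : realType.
Implicit Types (z p : R * R) (Phi : R -> R).
Notation mu2 := ((@lebesgue_measure R \x @lebesgue_measure R)%E).

Definition kernel_pow p (L : R) (M : nat) z : R * R :=
  iter M (cmul (cmul (L, 0) (cinv (csub z p)))) (1, 0).

Definition test_function p (L s0 : R) (M : nat) z : R * R := cmul (s0, 0) (kernel_pow p L M z).

Lemma cnorm_real (s : R) : 0 <= s -> cnorm (s, 0) = s.
Proof. by move=> s0; rewrite cnorm_horizontal ger0_norm. Qed.

Lemma cnorm_test_function p (L s0 : R) (M : nat) z : 0 <= L -> 0 <= s0 ->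
  cnorm (test_function p L s0 M z) = s0 * (L / cnorm (csub z p)) ^+ M.
Proof.
move=> L0 s00; rewrite cnormM cnorm_real//; congr (_ * _).
elim: M => [|M IH]; first by rewrite expr0 cnorm1.
by rewrite /kernel_pow iterS -/(kernel_pow p L M z) !cnormM cnormV cnorm_real// IH exprS.
Qed.

Lemma is_cderiv_test_function p (L s0 : R) (M : nat) z : z != p ->
  exists c, is_cderiv (test_function p L s0 M) z c.
Proof.
move=> zp.
suff [c kc] : exists c, is_cderiv (kernel_pow p L M) z c.
  by eexists; exact: is_cderivM (is_cderiv_cst (s0, 0) z) kc.
elim: M => [|M [c kc]]; first by exists (0, 0); exact: is_cderiv_cst.
have [d kd] := is_cderiv_invB zp.
eexists; exact: is_cderivM (is_cderivM (is_cderiv_cst (L, 0) z) kd) kc.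
Qed.

Lemma holomorphic_test_function (c L s0 : R) (M : nat) : 0 < L ->
  holomorphic_on (@Cplus R) (test_function (c, - L) L s0 M).
Proof.
move=> L0; apply/holomorphic_onP => z z0; apply: is_cderiv_test_function.
by apply: contraTneq z0 => ->; rewrite /Cplus /= oppr_gt0 -leNgt ltW.
Qed.

(** The modulus is s0 * k with k in [0, 1], so Phi(s0 * k) <= k * Phi(s0) = k / L^(2 + alpha), and
    the kernel integral cancels the power of [L]. Having K >= 1 allows rescaling by [K]
    afterwards. *)
Lemma orlicz_test_function Phi (alpha : R) : class_U Phi -> -1 < alpha ->
  exists (M : nat), exists2 K : R, 1 <= K & forall c L : R, 0 < L ->
    (orlicz_integral Phi alpha
      (test_function (c, - L) L (growth_inv Phi (1 / L `^ (2 + alpha))) M)%R 1 <= K%:E)%E.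
Proof.
move=> PhiU a1; have [M [C C0 CP]] := kernel_integral a1.
exists M; pose K := Num.max 1 C; have K1 : 1 <= K by rewrite le_max lexx.
have K0 : 0 < K by lra.
exists K => // c L L0.
have Lp : 0 < L `^ (2 + alpha) by rewrite powR_gt0.
have i0 : 0 < 1 / L `^ (2 + alpha) by rewrite divr_gt0.
have [s00 sE] := growth_invP PhiU (ltW i0).
set s0 := growth_inv Phi _ in s00 sE *.
set f := test_function _ _ _ _.
have hf : holomorphic_on (@Cplus R) f by exact: holomorphic_test_function.
pose k z := (L / cnorm (csub z (c, - L))) ^+ M.
have fE z : cnorm (f z) = s0 * k z by rewrite cnorm_test_function// ltW.
have k01 z : Cplus z -> 0 <= k z <= 1.
  move=> zC; have [H _] := @cnorm_kernel_ge _ c L z L0 zC.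
  have z0 : 0 < z.2 by exact: zC.
  have yL : 0 <= z.2 / L * L by rewrite mulr_ge0 ?divr_ge0// ltW.
  have Ln : L <= cnorm (csub z (c, - L)) by lra.
  have n0 := lt_le_trans L0 Ln.
  rewrite /k exprn_ge0 ?divr_ge0 ?(ltW L0) ?(ltW n0)//=.
  by rewrite exprn_ile1 ?divr_ge0 ?(ltW L0) ?(ltW n0)// ler_pdivrMr// mul1r.
have q0 : 0 <= (L `^ (2 + alpha))^-1 by rewrite invr_ge0 ltW.
have mk : measurable_fun (@Cplus R) (fun z => (k z * z.2 `^ alpha)%:E).
  have [s0E|s0n] := eqVneq s0 0.
    by move: i0; rewrite -sE s0E class_U0// ltxx.
  apply/measurable_EFinP; apply: measurable_funM; last exact: measurable_weight.
  have -> : k = (fun z => s0^-1 * cnorm (f z)) by apply/funext => z; rewrite fE mulKf.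
  apply: measurable_funM; first exact: measurable_cst.
  exact: holomorphic_measurable_cnorm.
have kw0 z : Cplus z -> (0 <= (k z * z.2 `^ alpha)%:E)%E.
  by move=> zC; rewrite lee_fin mulr_ge0 ?powR_ge0//; case/andP: (k01 z zC).
apply: (@le_trans _ _ (\int[mu2]_(z in @Cplus R)
    ((L `^ (2 + alpha))^-1%:E * (k z * z.2 `^ alpha)%:E))%E).
  apply: ge0_le_integral => //.
  - exact: measurable_Cplus.
  - by move=> z _; rewrite lee_fin orlicz_density_ge0.
  - exact: measurable_EFin_orlicz_density.
  - exact: measurable_funeM.
  - move=> z zC; rewrite -EFinM lee_fin mulrA ler_wpM2r ?powR_ge0// fE.
    rewrite divr1 mulrC; apply: (le_trans (class_U_scale PhiU (k01 z zC) s00)).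
    by rewrite sE div1r mulrC.
rewrite ge0_integralZl//; last exact: measurable_Cplus.
apply: (le_trans (lee_wpmul2l _ (CP c L L0))); first by rewrite lee_fin.
rewrite -EFinM lee_fin mulrCA mulVf ?gt_eqF// mulr1.
by rewrite le_max lexx orbT.
Qed.

(** The squared distance to the pole is at most L^2 + (2 L)^2 <= (3 L)^2. *)
Lemma test_function_lower (c L s0 : R) (M : nat) z : 0 < L -> 0 < s0 ->
  `|z.1 - c| <= L -> 0 < z.2 < L ->
  s0 / 3 ^+ M <= cnorm (test_function (c, - L) L s0 M z).
Proof.
move=> L0 s00 h1 /andP[z0 h2]; rewrite cnorm_test_function ?(ltW L0) ?(ltW s00)//.
rewrite ler_wpM2l ?(ltW s00)// -exprVn lerXn2r ?nnegrE ?divr_ge0 ?cnorm_ge0 ?(ltW L0)//.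
have n0 : 0 < cnorm (csub z (c, - L)).
  by apply: lt_le_trans (normr_snd_le _); rewrite /= opprK gtr0_norm; lra.
rewrite ler_pdivlMr// mulrC ler_pdivrMr// mulrC.
rewrite cnorm_leP ?mulr_ge0 ?(ltW L0)//= opprK.
have : (z.1 - c) ^+ 2 <= L ^+ 2.
  by rewrite -real_normK ?num_real// lerXn2r ?nnegrE ?(ltW L0).
have : (z.2 + L) ^+ 2 <= (2 * L) ^+ 2.
  by rewrite lerXn2r ?nnegrE; lra.
have := sqr_ge0 L; rewrite !exprMn; lra.
Qed.

Lemma weak_type_carleson (Phi1 Phi2 : R -> R) (mu : {measure set (R * R)%type -> \bar R})
    (alpha C2 : R) : class_U Phi1 -> class_U Phi2 -> -1 < alpha -> 0 < C2 ->
  (forall f (lam : R), bergman_orlicz Phi1 alpha f ->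
    (exists z, Cplus z /\ f z <> (0, 0)) -> 0 < lam ->
    ((Phi2 lam)%:E *
      mu [set z | Cplus z /\ (C2 * lam * lux_norm Phi1 alpha f < cnorm (f z))%R] <= 1)%E) ->
  exists2 C1 : R, 0 < C1 & carleson_condition Phi1 Phi2 alpha mu C1.
Proof.
move=> U1 U2 a1 C20 weak.
have [M [K K1 KP]] := orlicz_test_function U1 a1.
have K0 : 0 < K by lra.
have [q [_ [_ [C upper] _]]] := U2.
(* At the level lam = s0 / (2 C2 K 3^M) the weak type threshold is at most half of the lower bound
   s0 / 3^M on the box, hence strictly below it. As s0 <= lam * B, the upper growth of [Phi2] costs
   the factor C * B^q. *)
pose B := Num.max 1 (2 * C2 * K * 3 ^+ M).
have B1 : 1 <= B by rewrite le_max lexx.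
have B0 : 0 < B by lra.
(* The sign of [C] is not given; it is read off from the growth bound at s = 1, t = B. *)
have CB : 0 < C * B `^ q.
  have := upper 1 B ltr01 B1; rewrite mul1r => h.
  have := lt_le_trans (class_U_gt0 U2 B0) h.
  by rewrite pmulr_lgt0// class_U_gt0.
exists (C * B `^ q) => // a b I ab abI Iab.
set L := b - a; have L0 : 0 < L by rewrite subr_gt0.
set s0 := growth_inv Phi1 _.
have s00 : 0 < s0 by apply: (growth_inv_gt0 U1); rewrite divr_gt0// powR_gt0.
(* The pole lies below the left end of the interval: |x - a| <= L on [I] is all that the lower bound
   asks for. *)
set f := test_function (a, - L) L s0 M.
have hf : holomorphic_on (@Cplus R) f by exact: holomorphic_test_function.
have fK : (orlicz_integral Phi1 alpha f 1 <= K%:E)%E by exact: KP.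
have Bf : bergman_orlicz Phi1 alpha f by split=> //; apply: (le_lt_trans fK); rewrite ltry.
have NK : lux_norm Phi1 alpha f <= K.
  apply: lux_norm_le => //; rewrite -[X in orlicz_integral _ _ _ X]mulr1.
  apply: (le_trans (orlicz_integral_scale _ U1 hf ltr01 K1)).
  apply: (@le_trans _ _ (K^-1%:E * K%:E)%E).
    by apply: lee_wpmul2l => //; rewrite lee_fin invr_ge0 ltW.
  by rewrite -EFinM mulVf// gt_eqF.
have T0 : 0 < (3 : R) ^+ M by rewrite exprn_gt0.
pose lam := s0 / (2 * C2 * K * 3 ^+ M).
have lam0 : 0 < lam by rewrite divr_gt0 ?mulr_gt0.
have fbox z : carleson_box I L z -> s0 / 3 ^+ M <= cnorm (f z).
  move=> [/Iab/=]; rewrite in_itv/= => h1 h2; apply: test_function_lower => //.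
  by rewrite ler_norml /L; lra.
have fneq : exists z, Cplus z /\ f z <> (0, 0).
  exists ((a + b) / 2, L / 2); split; first by rewrite /Cplus /= divr_gt0.
  apply/eqP; rewrite -cnorm_gt0; apply: lt_le_trans (fbox _ _); first by rewrite divr_gt0.
  split; last by rewrite /=; lra.
  by apply: abI; rewrite /= in_itv/=; lra.
set E := [set z | Cplus z /\ (C2 * lam * lux_norm Phi1 alpha f < cnorm (f z))%R].
have boxE : carleson_box I L `<=` E.
  move=> z Iz; split; first by case: Iz => _ /andP[].
  apply: lt_le_trans (fbox z Iz); apply: (@le_lt_trans _ _ (C2 * lam * K)).
    by rewrite ler_wpM2l// ltW// mulr_gt0.
  have -> : C2 * lam * K = s0 / 3 ^+ M / 2 by rewrite /lam; field; rewrite !gt_eqF.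
  have : 0 < s0 / 3 ^+ M by rewrite divr_gt0.
  lra.
have mE : measurable E.
  apply: (@Cplus_superlevel_measurable _ (fun z => cnorm (f z))) => z zC.
  exact/ccontinuous_cnorm/(holomorphic_continuous_above hf).
(* [I] differs from an open interval by a subset of its two endpoints. *)
have mI : measurable I.
  have -> : I = `]a, b[ `|` (I `&` [set a; b]).
    apply/seteqP; split => [x Ix|x [/abI//|[]//]].
    have := Iab x Ix; rewrite /= in_itv/= => /andP[ax xb].
    have [xa|xna] := eqVneq x a; first by right; split; [exact: Ix|left].
    have [xb'|xnb] := eqVneq x b; first by right; split; [exact: Ix|right].
    by left; rewrite /= in_itv/= !lt_neqAle ax xb xnb eq_sym xna.
  apply: measurableU; first exact: measurable_itv.
  apply: countable_measurable => [x|]; first exact: measurable_set1.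
  by apply: finite_set_countable; apply: finite_setIr; exact: finite_set2.
have mbox : measurable (carleson_box I L).
  rewrite (_ : carleson_box I L = I `*` `]0, L[%classic).
    by apply: measurableX => //; exact: measurable_itv.
  by apply/seteqP; split => z [] /=; rewrite /carleson_box /= ?in_itv.
apply: (@le_trans _ _ (mu E)); first by apply: le_measure => //; rewrite inE.
have P2l := class_U_gt0 U2 lam0.
have P2s := class_U_gt0 U2 s00.
have := weak f lam Bf fneq lam0; rewrite -/E muleC -lee_pdivlMr// mul1e => /le_trans; apply.
rewrite lee_fin ler_pdivlMr// mulrC ler_pdivrMr//.
apply: (@le_trans _ _ (Phi2 (lam * B))).
  apply: (class_U_le U2) => //; first exact: ltW.
  apply: (@le_trans _ _ (lam * (2 * C2 * K * 3 ^+ M))).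
    by rewrite /lam divfK// gt_eqF// !mulr_gt0.
  by rewrite ler_wpM2l ?(ltW lam0)// le_max lexx orbT.
exact: upper.
Qed.

End TestFunctions.

Theorem theorem7p2 (R : realType) (Phi1 Phi2 : R -> R)
  (mu : {measure set (R * R)%type -> \bar R}) (alpha : R) :
  class_U Phi1 -> class_U Phi2 -> nabla2 Phi1 ->
  (forall s t : R, 0 < s -> s <= t -> Phi2 s / Phi1 s <= Phi2 t / Phi1 t) ->
  -1 < alpha ->
  (exists C1 : R, 0 < C1 /\
     forall (a b : R) (I : set R), a < b ->
       `]a, b[ `<=` I -> I `<=` `[a, b] ->
       (mu (carleson_box I (b - a))
          <= (C1 / Phi2 (growth_inv Phi1 (1 / (b - a) `^ (2 + alpha))))%:E)%E)
  <->
  (exists C2 : R, 0 < C2 /\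
     forall f : R * R -> R * R, bergman_orlicz Phi1 alpha f ->
       (exists z, Cplus z /\ f z <> (0, 0)) ->
       (ereal_sup [set ((Phi2 lam)%:E *
            mu [set z | Cplus z /\ (C2 * lam * lux_norm Phi1 alpha f < cnorm (f z))%R])%E
          | lam in [set lam : R | (0 < lam)%R]] <= 1)%E).
Proof.
move=> U1 U2 _ ratio a1; split.
- move=> [C1 [C10 carl]].
  have [C2 C20 weak] := carleson_weak_type U1 U2 ratio C10 carl.
  exists C2; split=> // f Bf fneq.
  by apply: ge_ereal_sup => _ [lam /= lam0 <-]; exact: weak.
- move=> [C2 [C20 weak]].
  have [f lam Bf fneq lam0|C1 C10 carl] := weak_type_carleson (mu := mu) U1 U2 a1 C20.
    by apply: le_trans (weak f Bf fneq); apply: ereal_sup_ubound; exists lam.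
  by exists C1; split.
Qed.
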